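(* Let $R$ be a commutative unital ring and let $\Lambda$ be a finitely aligned $k$-graph such that $\Lambda^0_{\geq v}:=\{w\in\Lambda^0:v\le w\}$ is finite for every $v\in\Lambda^0$. Suppose also that the Kumjian-Pask algebra $\mathrm{KP}_R(\Lambda)$ is simple. If $\Lambda$ has no cycles, then $\mathrm{KP}_R(\Lambda)$ is locally matricial; otherwise, $\mathrm{KP}_R(\Lambda)$ is purely infinite simple.
   Context: $\mathbb{N}$ is the set of non-negative integers and $k\ge 1$ is an integer. $\mathbb{N}^k$ carries pointwise addition and the coordinatewise partial order $\le$; $m\vee n$ is the coordinatewise maximum. **$k$-graphs.** A $k$-graph is a countable small category $\Lambda$ with range and source maps $r,s$, together with a functor $d:\Lambda\to\mathbb{N}^k$ such that whenever $d(\lambda)=m+n$ there are unique $\lambda_1,\lambda_2\in\Lambda$ with $d(\lambda_1)=m$, $d(\lambda_2)=n$, $\lambda=\lambda_1\lambda_2$. Objects (vertices) are identified with the paths of degree $0$; their set is $\Lambda^0$. The composite $\lambda\mu$ is defined iff $s(\lambda)=r(\mu)$. Write $v\Lambda=\{\lambda: r(\lambda)=v\}$, and $v\le w$ if there is $\lambda\in\Lambda$ with $r(\lambda)=v$, $s(\lambda)=w$. $\mathrm{MCE}(\mu,\nu)$ is the set of paths $\lambda$ with $d(\lambda)=d(\mu)\vee d(\nu)$ and $\lambda=\mu\alpha=\nu\beta$ for some $\alpha,\beta\in\Lambda$, and $\Lambda^{\min}(\mu,\nu)=\{(\alpha,\beta):\mu\alpha=\nu\beta\in\mathrm{MCE}(\mu,\nu)\}$.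 $\Lambda$ is finitely aligned if $\Lambda^{\min}(\mu,\nu)$ is finite (possibly empty) for all $\mu,\nu$. A cycle is a path $\mu$ with $d(\mu)\ne0$ and $s(\mu)=r(\mu)$. **Exhaustive sets.** $E\subseteq v\Lambda$ is exhaustive if for every $\lambda\in v\Lambda$ there is $\mu\in E$ with $\Lambda^{\min}(\lambda,\mu)\neq\emptyset$. $v\mathrm{FE}(\Lambda)$ is the collection of finite exhaustive sets $E\subseteq v\Lambda\setminus\{v\}$. **Kumjian-Pask algebra.** A Kumjian-Pask $\Lambda$-family in an $R$-algebra is a collection $\{S_\lambda,S_{\lambda^*}:\lambda\in\Lambda\}$ (with $S_{v^*}=S_v$ for $v\in\Lambda^0$) such that: (KP1) $S_vS_w=\delta_{v,w}S_v$ for $v,w\in\Lambda^0$; (KP2) $S_\mu S_\nu=S_{\mu\nu}$ and $S_{\nu^*}S_{\mu^*}=S_{(\mu\nu)^*}$ when $s(\mu)=r(\nu)$; (KP3) $S_{\mu^*}S_\nu=\sum_{(\alpha,\beta)\in\Lambda^{\min}(\mu,\nu)}S_\alpha S_{\beta^*}$ for all $\mu,\nu$; (KP4) $\prod_{\mu\in E}(S_v-S_\mu S_{\mu^*})=0$ for all $v\in\Lambda^0$, $E\in v\mathrm{FE}(\Lambda)$. $\mathrm{KP}_R(\Lambda)$ is the universal $R$-algebra generated by a Kumjian-Pask $\Lambda$-family $\{s_\lambda,s_{\lambda^*}\}$ (not necessarily unital). **Purely infinite; locally matricial.** An idempotent $e$ of a ring $A$ is infinite if $eA$ is isomorphic,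 as a right $A$-module, to a proper direct summand of itself. $A$ is purely infinite if every nonzero right ideal of $A$ contains an infinite idempotent. Purely infinite simple means purely infinite and simple (simple rings are nonzero). An $R$-algebra is matricial if it is isomorphic to a finite direct product of full matrix algebras $\mathbb{M}_{n}(R)$ with $n$ finite, and locally matricial if it is the directed union of matricial subalgebras (not necessarily sharing a unit). *)

(* Defs.v *)
From HB Require Import structures.
From mathcomp Require Import all_boot all_order all_algebra finmap.
From mathcomp Require Import boolp classical_sets functions cardinality fsbigop.

Set Implicit Arguments.
Unset Strict Implicit.
Unset Printing Implicit Defensive.

Import GRing.Theory.
Local Open Scope classical_set_scope.
Local Open Scope ring_scope.

HB.mixin Record isNuAlgebra (R : comPzRingType) A & GRing.Lmodule R A := {
  nmul : A -> A -> A;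
  nmulA : associative nmul;
  nmulDl : left_distributive nmul +%R;
  nmulDr : right_distributive nmul +%R;
  nscaleAl : forall (a : R) (x y : A), a *: nmul x y = nmul (a *: x) y;
  nscaleAr : forall (a : R) (x y : A), a *: nmul x y = nmul x (a *: y)
}.

#[short(type="nuAlgType")]
HB.structure Definition NuAlgebra (R : comPzRingType) :=
  { A of GRing.Lmodule R A & isNuAlgebra R A }.

Notation "x ** y" := (nmul x y) (at level 40, left associativity) : ring_scope.

Definition nualg_hom (R : comPzRingType) (A B : nuAlgType R) (f : A -> B) :=
  [/\ forall x y, f (x + y) = f x + f y,
      forall (a : R) x, f (a *: x) = a *: f x &
      forall x y, f (x ** y) = f x ** f y].

Section RingNotions.
Context (R : comPzRingType) (A : nuAlgType R).

Definition additive_subgroup (I : set A) :=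
  I 0 /\ forall x y, I x -> I y -> I (x - y).

Definition right_ideal (I : set A) :=
  additive_subgroup I /\ forall x a, I x -> I (x ** a).

Definition two_sided_ideal (I : set A) :=
  right_ideal I /\ forall a x, I x -> I (a ** x).

Definition simple_ring :=
  (exists x : A, x != 0) /\
  forall I : set A, two_sided_ideal I -> I = [set 0] \/ I = setT.

(* The right [A]-submodules of [A] are its right ideals. *)
Definition direct_summand (P M : set A) :=
  right_ideal P /\
  exists Q : set A, [/\ right_ideal Q,
    M = [set x + y | x in P & y in Q] & P `&` Q = [set 0]].

(* Only the values of [f] on [M] matter. *)
Definition right_module_iso (M N : set A) :=
  exists f : A -> A,
    [/\ forall x y, M x -> M y -> f (x + y) = f x + f y,
        forall x a, M x -> f (x ** a) = f x ** a &
        set_bij M N f].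

Definition principal_right (e : A) : set A := range (fun a => e ** a).

Definition infinite_idempotent (e : A) :=
  e ** e = e /\
  exists P : set A, [/\ direct_summand P (principal_right e),
    P <> principal_right e & right_module_iso (principal_right e) P].

Definition purely_infinite :=
  forall I : set A, right_ideal I -> I <> [set 0] ->
    exists2 e, I e & infinite_idempotent e.

Definition purely_infinite_simple := purely_infinite /\ simple_ring.

(* [B] is the image of an injective algebra homomorphism defined on the product
   of the matrix algebras of sizes [(n i).+1]; in particular it is a subalgebra. *)
Definition matricial_subalgebra (B : set A) :=
  exists (l : nat) (n : 'I_l -> nat)
         (phi : (forall i : 'I_l, 'M[R]_((n i).+1)) -> A),
    [/\ forall X Y, phi (fun i => X i + Y i) = phi X + phi Y,
        forall (a : R) X, phi (fun i => a *: X i) = a *: phi X,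
        forall X Y, phi (fun i => X i *m Y i) = phi X ** phi Y,
        injective phi & range phi = B].

Definition locally_matricial :=
  exists F : set (set A),
    [/\ forall B, F B -> matricial_subalgebra B,
        forall B C, F B -> F C -> exists2 D, F D & B `|` C `<=` D &
        \bigcup_(B in F) B = setT].

End RingNotions.

Arguments simple_ring {R} A.
Arguments purely_infinite {R} A.
Arguments purely_infinite_simple {R} A.
Arguments locally_matricial {R} A.

Notation degree k := {ffun 'I_k -> nat}.

Definition degree_join k (m n : degree k) : degree k :=
  [ffun i => maxn (m i) (n i)].

(* Composition is a total function, but [pcomp f g] is meaningful only when
   [src f = rng g]; its other values are unconstrained and never used. *)
Record kgraph (k : nat) := KGraph {
  vertex : countType;
  kpath : countType;
  rng : kpath -> vertex;
  src : kpath -> vertex;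
  vid : vertex -> kpath;
  pcomp : kpath -> kpath -> kpath;
  deg : kpath -> degree k;
  rng_vid : forall v, rng (vid v) = v;
  src_vid : forall v, src (vid v) = v;
  rng_comp : forall f g, src f = rng g -> rng (pcomp f g) = rng f;
  src_comp : forall f g, src f = rng g -> src (pcomp f g) = src g;
  comp_vidl : forall f, pcomp (vid (rng f)) f = f;
  comp_vidr : forall f, pcomp f (vid (src f)) = f;
  pcompA : forall f g h, src f = rng g -> src g = rng h ->
    pcomp f (pcomp g h) = pcomp (pcomp f g) h;
  deg_vid : forall v, deg (vid v) = 0;
  deg_comp : forall f g, src f = rng g -> deg (pcomp f g) = deg f + deg g;
  factorization : forall f (m n : degree k), deg f = m + n ->
    exists! gh : kpath * kpath,
      [/\ src gh.1 = rng gh.2, deg gh.1 = m, deg gh.2 = n &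
          f = pcomp gh.1 gh.2]
}.

Section KGraphNotions.
Context (k : nat) (L : kgraph k).
Implicit Types (v w : vertex L) (lam mu nu : kpath L).

Lemma deg0P lam : deg lam = 0 <-> exists v, lam = vid v.
Proof.
split=> [d0|[v ->]]; last exact: deg_vid.
have dE : deg lam = (0 : degree k) + 0 by rewrite addr0.
have [gh [_ uniq_gh]] := factorization dE.
have h1 : gh = (vid (rng lam), lam).
  by apply: uniq_gh; split; rewrite ?src_vid ?deg_vid ?comp_vidl.
have h2 : gh = (lam, vid (src lam)).
  by apply: uniq_gh; split; rewrite ?rng_vid ?deg_vid ?comp_vidr.
by exists (rng lam); move: h2; rewrite h1 => -[].
Qed.

Definition vle v w := exists lam, rng lam = v /\ src lam = w.

Definition MCE mu nu : set (kpath L) :=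
  [set lam | deg lam = degree_join (deg mu) (deg nu) /\
    exists al be, [/\ src mu = rng al, src nu = rng be,
                      lam = pcomp mu al & lam = pcomp nu be]].

Definition Lmin mu nu : set (kpath L * kpath L) :=
  [set p | [/\ src mu = rng p.1, src nu = rng p.2,
               pcomp mu p.1 = pcomp nu p.2 & MCE mu nu (pcomp mu p.1)]].

Definition finitely_aligned := forall mu nu, finite_set (Lmin mu nu).

Definition is_cycle mu := deg mu <> 0 /\ src mu = rng mu.

Definition exhaustive v (E : set (kpath L)) :=
  (forall mu, E mu -> rng mu = v) /\
  forall lam, rng lam = v -> exists2 mu, E mu & Lmin lam mu !=set0.

Definition FE v (E : {fset kpath L}) :=
  exhaustive v [set` E] /\ vid v \notin E.

End KGraphNotions.

Arguments finitely_aligned {k} L.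

(* In [KP3] the index set is finite as soon as [L] is finitely aligned.  In
   [KP4] the factors commute by [KP1]-[KP3], so that the order of the product is
   irrelevant, and [S (vid v)] is an identity for each of them, so that it
   may stand for the empty product in an algebra without a unit. *)
Record KP_family (R : comPzRingType) (k : nat) (L : kgraph k) (B : nuAlgType R)
    (S Sg : kpath L -> B) : Prop := KPFamily {
  KP0 : forall v, Sg (vid v) = S (vid v);
  KP1 : forall v w,
    S (vid v) ** S (vid w) = if v == w then S (vid v) else 0;
  KP2 : forall mu nu, src mu = rng nu ->
    S mu ** S nu = S (pcomp mu nu) /\ Sg nu ** Sg mu = Sg (pcomp mu nu);
  KP3 : forall mu nu,
    Sg mu ** S nu = \sum_(p \in Lmin mu nu) (S p.1 ** Sg p.2);
  KP4 : forall v (E : {fset kpath L}), FE v E ->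
    \big[@nmul R B / S (vid v)]_(mu <- E) (S (vid v) - S mu ** Sg mu) = 0
}.

(* [KP R L] is built as the formal expressions in the generators, modulo the
   identities that hold in every Kumjian-Pask family; its universal property is
   [KP_universal] below. *)
Inductive kp_term (R : Type) (X : Type) : Type :=
  | TGen of X
  | TGhost of X
  | TZero
  | TAdd of kp_term R X & kp_term R X
  | TScale of R & kp_term R X
  | TMul of kp_term R X & kp_term R X.

Arguments TGen {R X}.
Arguments TGhost {R X}.
Arguments TZero {R X}.

HB.instance Definition _ (R X : Type) := gen_eqMixin (kp_term R X).
HB.instance Definition _ (R X : Type) := gen_choiceMixin (kp_term R X).

Section KP.
Context (R : comPzRingType) (k : nat) (L : kgraph k).
Local Notation term := (kp_term R (kpath L)).

Fixpoint kp_eval (B : nuAlgType R) (S Sg : kpath L -> B) (t : term) : B :=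
  match t with
  | TGen mu => S mu
  | TGhost mu => Sg mu
  | TZero => 0
  | TAdd t u => kp_eval S Sg t + kp_eval S Sg u
  | TScale a t => a *: kp_eval S Sg t
  | TMul t u => kp_eval S Sg t ** kp_eval S Sg u
  end.

Definition kp_eq (t u : term) : Prop :=
  forall (B : nuAlgType R) (S Sg : kpath L -> B),
    KP_family S Sg -> kp_eval S Sg t = kp_eval S Sg u.

Definition kp_eqb (t u : term) : bool := `[< kp_eq t u >].

Lemma kp_eqb_refl : reflexive kp_eqb.
Proof. by move=> t; apply/asboolP. Qed.

Lemma kp_eqb_sym : symmetric kp_eqb.
Proof.
by move=> t u; apply/asboolP/asboolP => tu B S Sg fam; rewrite (tu B S Sg fam).
Qed.

Lemma kp_eqb_trans : transitive kp_eqb.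
Proof.
move=> u t w /asboolP tu /asboolP uw; apply/asboolP => B S Sg fam.
by rewrite (tu B S Sg fam) (uw B S Sg fam).
Qed.

Canonical kp_equiv := EquivRel kp_eqb kp_eqb_refl kp_eqb_sym kp_eqb_trans.

Definition KP := {eq_quot kp_equiv}%qT.
HB.instance Definition _ := Choice.on KP.

Definition kp_class (t : term) : KP := \pi_({eq_quot kp_equiv})%qT t.

Lemma kp_classP t u : kp_class t = kp_class u <-> kp_eq t u.
Proof.
split=> [/eqmodP /asboolP //|tu].
by apply/eqmodP/asboolP.
Qed.

Definition kp_lift (B : nuAlgType R) (S Sg : kpath L -> B) (x : KP) : B :=
  kp_eval S Sg (repr x).

Lemma kp_liftE (B : nuAlgType R) (S Sg : kpath L -> B) t : KP_family S Sg ->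
  kp_lift S Sg (kp_class t) = kp_eval S Sg t.
Proof.
move=> fam; have /kp_classP : kp_class (repr (kp_class t)) = kp_class t.
  exact: reprK.
exact.
Qed.

Lemma kp_ext (x y : KP) :
  (forall (B : nuAlgType R) (S Sg : kpath L -> B), KP_family S Sg ->
     kp_lift S Sg x = kp_lift S Sg y) -> x = y.
Proof.
move=> xy; rewrite -[x]reprK -[y]reprK; apply/kp_classP => B S Sg fam.
exact: xy.
Qed.

Definition kp_zero : KP := kp_class TZero.
Definition kp_add (x y : KP) : KP := kp_class (TAdd (repr x) (repr y)).
Definition kp_scale (a : R) (x : KP) : KP := kp_class (TScale a (repr x)).
Definition kp_opp (x : KP) : KP := kp_scale (-1) x.
Definition kp_mul (x y : KP) : KP := kp_class (TMul (repr x) (repr y)).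


Section Eval.
Context (B : nuAlgType R) (S Sg : kpath L -> B) (fam : KP_family S Sg).

Lemma kp_lift0 : kp_lift S Sg kp_zero = 0.
Proof. exact: kp_liftE. Qed.

Lemma kp_liftD x y : kp_lift S Sg (kp_add x y) = kp_lift S Sg x + kp_lift S Sg y.
Proof. exact: kp_liftE. Qed.

Lemma kp_liftZ a x : kp_lift S Sg (kp_scale a x) = a *: kp_lift S Sg x.
Proof. exact: kp_liftE. Qed.

Lemma kp_liftM x y : kp_lift S Sg (kp_mul x y) = kp_lift S Sg x ** kp_lift S Sg y.
Proof. exact: kp_liftE. Qed.

Lemma kp_liftN x : kp_lift S Sg (kp_opp x) = - kp_lift S Sg x.
Proof. by rewrite kp_liftZ scaleN1r. Qed.

End Eval.

Definition kp_lift_simp := (kp_lift0, kp_liftD, kp_liftN, kp_liftZ, kp_liftM).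

Lemma kp_addA : associative kp_add.
Proof. by move=> x y z; apply: kp_ext => B S Sg f; rewrite !kp_lift_simp ?addrA. Qed.

Lemma kp_addC : commutative kp_add.
Proof. by move=> x y; apply: kp_ext => B S Sg f; rewrite !kp_lift_simp // addrC. Qed.

Lemma kp_add0 : left_id kp_zero kp_add.
Proof. by move=> x; apply: kp_ext => B S Sg f; rewrite !kp_lift_simp ?add0r. Qed.

Lemma kp_addN : left_inverse kp_zero kp_opp kp_add.
Proof. by move=> x; apply: kp_ext => B S Sg f; rewrite !kp_lift_simp ?addNr. Qed.

HB.instance Definition _ :=
  GRing.isZmodule.Build KP kp_addA kp_addC kp_add0 kp_addN.

Lemma kp_scaleA a b x : kp_scale a (kp_scale b x) = kp_scale (a * b) x.
Proof. by apply: kp_ext => B S Sg f; rewrite !kp_lift_simp ?scalerA. Qed.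

Lemma kp_scale1 : left_id 1 kp_scale.
Proof. by move=> x; apply: kp_ext => B S Sg f; rewrite !kp_lift_simp ?scale1r. Qed.

Lemma kp_scaleDr : right_distributive kp_scale +%R.
Proof. by move=> a x y; apply: kp_ext => B S Sg f; rewrite !kp_lift_simp ?scalerDr. Qed.

Lemma kp_scaleDl x : {morph kp_scale^~ x : a b / a + b}.
Proof. by move=> a b; apply: kp_ext => B S Sg f; rewrite !kp_lift_simp ?scalerDl. Qed.

HB.instance Definition _ :=
  GRing.Zmodule_isLmodule.Build R KP kp_scaleA kp_scale1 kp_scaleDr kp_scaleDl.

Lemma kp_mulA : associative kp_mul.
Proof. by move=> x y z; apply: kp_ext => B S Sg f; rewrite !kp_lift_simp ?nmulA. Qed.

Lemma kp_mulDl : left_distributive kp_mul +%R.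
Proof. by move=> x y z; apply: kp_ext => B S Sg f; rewrite !kp_lift_simp ?nmulDl. Qed.

Lemma kp_mulDr : right_distributive kp_mul +%R.
Proof. by move=> x y z; apply: kp_ext => B S Sg f; rewrite !kp_lift_simp ?nmulDr. Qed.

Lemma kp_scaleAl (a : R) (x y : KP) : a *: kp_mul x y = kp_mul (a *: x) y.
Proof. by apply: kp_ext => B S Sg f; rewrite !kp_lift_simp ?nscaleAl. Qed.

Lemma kp_scaleAr (a : R) (x y : KP) : a *: kp_mul x y = kp_mul x (a *: y).
Proof. by apply: kp_ext => B S Sg f; rewrite !kp_lift_simp ?nscaleAr. Qed.

HB.instance Definition _ :=
  isNuAlgebra.Build R KP kp_mulA kp_mulDl kp_mulDr kp_scaleAl kp_scaleAr.

Definition kp_s (mu : kpath L) : KP := kp_class (TGen mu).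
Definition kp_sg (mu : kpath L) : KP := kp_class (TGhost mu).

Lemma kp_lift_hom (B : nuAlgType R) (S Sg : kpath L -> B) :
  KP_family S Sg -> nualg_hom (kp_lift S Sg).
Proof. by move=> f; split=> *; [apply: kp_liftD|apply: kp_liftZ|apply: kp_liftM]. Qed.

Lemma nualg_hom0 (A B : nuAlgType R) (f : A -> B) : nualg_hom f -> f 0 = 0.
Proof. by case=> _ fZ _; rewrite -[0 in LHS](scale0r 0) fZ scale0r. Qed.

Lemma nualg_homB (A B : nuAlgType R) (f : A -> B) x y :
  nualg_hom f -> f (x - y) = f x - f y.
Proof. by case=> fD fZ _; rewrite fD -scaleN1r fZ scaleN1r. Qed.

Theorem kp_family : finitely_aligned L -> KP_family kp_s kp_sg.
Proof.
move=> fa.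
have sE (B : nuAlgType R) (S Sg : kpath L -> B) mu :
  KP_family S Sg -> kp_lift S Sg (kp_s mu) = S mu by move=> f; exact: kp_liftE.
have gE (B : nuAlgType R) (S Sg : kpath L -> B) mu :
  KP_family S Sg -> kp_lift S Sg (kp_sg mu) = Sg mu by move=> f; exact: kp_liftE.
have mE (B : nuAlgType R) (S Sg : kpath L -> B) (x y : KP) :
  KP_family S Sg -> kp_lift S Sg (x ** y) = kp_lift S Sg x ** kp_lift S Sg y.
  by move=> f; exact: kp_liftM.
split.
- by move=> v; apply: kp_ext => B S Sg f; rewrite sE // gE // (KP0 f).
- move=> v w; apply: kp_ext => B S Sg f; rewrite mE // !sE // (KP1 f).
  by case: eqP => _; rewrite ?sE ?(nualg_hom0 (kp_lift_hom f)).
- move=> mu nu e; split; apply: kp_ext => B S Sg f; rewrite mE // ?sE // ?gE //;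
  by case: (KP2 f e).
- move=> mu nu; apply: kp_ext => B S Sg f; rewrite mE // sE // gE // (KP3 f).
  rewrite !fsbig_finite //=; do 2?exact: fa.
  elim: (enum_fset _) => [|p l IHl]; first by rewrite !big_nil (kp_lift0 f).
  by rewrite !big_cons (kp_liftD f) -IHl mE // sE // gE.
- move=> v E FEE; apply: kp_ext => B S Sg f.
  rewrite (nualg_hom0 (kp_lift_hom f)) -(KP4 f FEE).
  elim: (enum_fset _) => [|p l IHl]; first by rewrite !big_nil sE.
  rewrite !big_cons mE // IHl; congr (_ ** _).
  by rewrite (nualg_homB _ _ (kp_lift_hom f)) mE // !sE // gE.
Qed.

Theorem KP_universal (B : nuAlgType R) (S Sg : kpath L -> B) :
  KP_family S Sg ->
  exists! f : KP -> B, [/\ nualg_hom f, f \o kp_s = S & f \o kp_sg = Sg].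
Proof.
move=> fam; exists (kp_lift S Sg); split.
  split; first exact: kp_lift_hom.
    by apply/funext => mu; exact: kp_liftE.
  by apply/funext => mu; exact: kp_liftE.
move=> f [hf fs fg]; case: (hf) => fD fZ fM.
apply/funext => x; rewrite -[x]reprK -/(kp_class _) kp_liftE //.
have eD t u : kp_class (TAdd t u) = kp_class t + kp_class u.
  by apply: kp_ext => C T Tg famT; rewrite kp_liftD // !kp_liftE.
have eZ a t : kp_class (TScale a t) = a *: kp_class t.
  by apply: kp_ext => C T Tg famT; rewrite kp_liftZ // !kp_liftE.
have eM t u : kp_class (TMul t u) = kp_class t ** kp_class u.
  by apply: kp_ext => C T Tg famT; rewrite kp_liftM // !kp_liftE.
elim: (repr x) => [mu|mu||t IHt u IHu|a t IHt|t IHt u IHu] /=.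
- by rewrite -fs.
- by rewrite -fg.
- by rewrite (nualg_hom0 hf).
- by rewrite eD fD IHt IHu.
- by rewrite eZ fZ IHt.
- by rewrite eM fM IHt IHu.
Qed.

End KP.

Arguments KP R {k} L.

(* Main.v *)
From HB Require Import structures.
From mathcomp Require Import all_boot all_algebra finmap.
From mathcomp Require Import boolp classical_sets functions cardinality fsbigop.
Require Import Defs.

(** Let [X] be the space of ultrafilters of paths: sets of paths that are closed
    under prefixes, directed, and maximal in the sense that a path outside the
    set is incompatible with a member of it.  Prepending and removing paths makes
    the functions on [X * int] a representation of [KP R L], twisted by any
    integer-valued cocycle on paths.  No vertex acts as zero, so when [KP R L] is
    simple all of these are faithful.

    Simplicity implies aperiodicity: if [rho <> sig] have the same source and stay
    compatible after every common extension, they prepend alike to ultrafilters,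
    so their ghosts act alike for the zero cocycle; but the cocycle given by a
    coordinate in which their degrees differ separates them.  With aperiodicity
    one compresses any nonzero element to a nonzero multiple of a vertex
    idempotent, and simplicity makes the scalar invertible.

    Simplicity also makes the vertices directed, so by finiteness there is a
    vertex [u] above all others.  If a cycle passes through [u], aperiodicity makes
    the idempotent of [u] infinite.  Otherwise [u] is a sink, the paths ending at
    [u] give matrix units spanning [KP R L], and there is no cycle at all, since a
    cycle at [v] would give infinitely many paths from [v] to [u]. *)

Set Implicit Arguments.
Unset Strict Implicit.
Unset Printing Implicit Defensive.

Import GRing.Theory.
Local Open Scope classical_set_scope.
Local Open Scope ring_scope.

(** * Paths *)

Section Paths.
Context (k : nat) (L : kgraph k).
Implicit Types (lam mu nu al be : kpath L) (v w : vertex L).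

Definition pfx mu lam := exists2 al, src mu = rng al & lam = pcomp mu al.

Definition compat mu nu := exists lam, pfx mu lam /\ pfx nu lam.

(** Cancelling [deg mu] in the degree of the common composite gives [deg al = deg be], so both pairs
    factor one path in the same degrees and unique factorization identifies them. *)
Lemma pcomp_inj mu nu al be :
  src mu = rng al -> src nu = rng be -> pcomp mu al = pcomp nu be ->
  deg mu = deg nu -> mu = nu /\ al = be.
Proof.
move=> e1 e2 e d.
have dal : deg al = deg be.
  have := deg_comp e1; rewrite e deg_comp // -d => /ffunP h.
  by apply/ffunP => i; have := h i; rewrite !ffunE => /addnI.
have [gh [_ uniq_gh]] := factorization (deg_comp e1).
have h1 : gh = (mu, al) by apply: uniq_gh; split.
have h2 : gh = (nu, be) by apply: uniq_gh; split=> //; rewrite e1.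
by move: h2; rewrite h1 => -[].
Qed.

Lemma pcompI mu al be : src mu = rng al -> src mu = rng be ->
  pcomp mu al = pcomp mu be -> al = be.
Proof. by move=> e1 e2 e; case: (pcomp_inj e1 e2 e). Qed.

Lemma pfx_refl mu : pfx mu mu.
Proof. by exists (vid (src mu)); rewrite ?rng_vid ?comp_vidr. Qed.

Lemma pfx_comp mu al : src mu = rng al -> pfx mu (pcomp mu al).
Proof. by exists al. Qed.

Lemma pfx_trans mu nu lam : pfx mu nu -> pfx nu lam -> pfx mu lam.
Proof.
move=> [al e1 ->] [be e2 ->]; rewrite src_comp // in e2.
by exists (pcomp al be); rewrite ?rng_comp // pcompA.
Qed.

Lemma pfx_rng mu lam : pfx mu lam -> rng mu = rng lam.
Proof. by move=> [al e ->]; rewrite rng_comp. Qed.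

Lemma pfx_vid mu : pfx (vid (rng mu)) mu.
Proof. by exists mu; rewrite ?src_vid ?comp_vidl. Qed.

Lemma pfx_mull mu al be : src mu = rng al -> pfx al be ->
  pfx (pcomp mu al) (pcomp mu be).
Proof.
move=> e [ga e1 ->]; exists ga; first by rewrite src_comp.
by rewrite pcompA.
Qed.

Lemma pfx_mulI mu al be : src mu = rng al -> src mu = rng be ->
  pfx (pcomp mu al) (pcomp mu be) -> pfx al be.
Proof.
move=> e1 e2 [ga]; rewrite src_comp // => e3 e; exists ga => //.
by apply: (@pcompI mu); rewrite ?rng_comp // pcompA.
Qed.

Lemma pfx_exists lam (m : degree k) : (forall i, m i <= deg lam i)%N ->
  exists2 mu, pfx mu lam & deg mu = m.
Proof.
move=> le_m; pose n : degree k := [ffun i => (deg lam i - m i)%N].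
have E : deg lam = m + n.
  by apply/ffunP => i; rewrite !ffunE; exact/esym/subnKC/le_m.
have [[g h] [[/= e dg dh ->] _]] := factorization E.
by exists g => //; exists h.
Qed.

Lemma pfx_leq mu lam i : pfx mu lam -> (deg mu i <= deg lam i)%N.
Proof. by move=> [al e ->]; rewrite deg_comp // ffunE leq_addr. Qed.

(** A prefix of [lam] is determined by its degree: [nu] is cut at degree [deg mu], and the piece
    obtained, being also a prefix of [lam], must be [mu]. *)
Lemma pfx_chain mu nu lam : pfx mu lam -> pfx nu lam ->
  (forall i, deg mu i <= deg nu i)%N -> pfx mu nu.
Proof.
move=> [al e1 E1] nul le_d; have [mu' p d] := pfx_exists le_d.
have [be e2 E2] := pfx_trans p nul.
have [<-//] : mu' = mu /\ be = al.
by apply: pcomp_inj; rewrite -?E1 -?E2.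
Qed.

Lemma pfx_uniq mu nu lam : pfx mu lam -> pfx nu lam -> deg mu = deg nu ->
  mu = nu.
Proof.
move=> [al e1 E1] [be e2 E2] d.
by have [] : mu = nu /\ al = be by apply: pcomp_inj; rewrite -?E1 -?E2.
Qed.

(** Cutting [lam] at the join of the two degrees gives a minimal common extension through which
    [lam] passes. *)
Lemma Lmin_pfx mu nu lam : pfx mu lam -> pfx nu lam ->
  exists p, Lmin mu nu p /\ pfx (pcomp mu p.1) lam.
Proof.
move=> m n; have le_j i : (degree_join (deg mu) (deg nu) i <= deg lam i)%N.
  by rewrite ffunE geq_max !pfx_leq.
have [ka p d] := pfx_exists le_j.
have [|al e1 E1] := pfx_chain m p.
  by move=> i; rewrite d ffunE leq_maxl.
have [|be e2 E2] := pfx_chain n p.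
  by move=> i; rewrite d ffunE leq_maxr.
exists (al, be); rewrite /= -E1; split=> //; split; rewrite /= -?E1 //.
by split=> //; exists al, be; split.
Qed.

Lemma Lmin_compat mu nu : (Lmin mu nu !=set0) <-> compat mu nu.
Proof.
split=> [[[al be] [/= e1 e2 E _]]|[lam [m n]]].
  by exists (pcomp mu al); split; [exists al|rewrite E; exists be].
by have [p [? _]] := Lmin_pfx m n; exists p.
Qed.

Lemma compatC mu nu : compat mu nu -> compat nu mu.
Proof. by move=> [lam [m n]]; exists lam. Qed.

Lemma compat_pfx mu nu mu' nu' : pfx mu mu' -> pfx nu nu' ->
  compat mu' nu' -> compat mu nu.
Proof.
move=> m n [lam [m' n']]; exists lam.
by split; [exact: pfx_trans m'|exact: pfx_trans n'].
Qed.

Lemma compat_mull mu al be : src mu = rng al -> src mu = rng be ->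
  compat (pcomp mu al) (pcomp mu be) -> compat al be.
Proof.
move=> e1 e2 [lam [m n]].
have [ga e3 E] := pfx_trans (pfx_comp e1) m.
by exists ga; split; apply: (@pfx_mulI mu); rewrite -?E.
Qed.

(** Both first components are prefixes of [lam] whose degree is the join minus [deg mu]. On an
    ultrafilter this leaves at most one nonzero term in the sum of (KP3). *)
Lemma Lmin_uniq mu nu p q lam : Lmin mu nu p -> Lmin mu nu q ->
  pfx p.1 lam -> pfx q.1 lam -> p = q.
Proof.
case: p => al be; case: q => al' be'.
move=> [/= e1 e2 E [d _]] [/= e1' e2' E' [d' _]] m n.
have aa : al = al'.
  apply: pfx_uniq m n _; move: d; rewrite -d' !deg_comp // => /ffunP h.
  by apply/ffunP => i; have := h i; rewrite !ffunE => /addnI.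
subst al'; congr (_, _); apply: (@pcompI nu) => //.
by rewrite -E -E'.
Qed.

Lemma Lmin_refl mu : Lmin mu mu = [set (vid (src mu), vid (src mu))].
Proof.
apply/seteqP; split=> [[al be]|_ ->].
  move=> [/= e1 e2 E [d _]]; have := pcompI e1 e2 E => <-.
  have d0 : deg al = 0.
    move: d; rewrite deg_comp // => /ffunP h.
    by apply/ffunP => i; have := h i; rewrite !ffunE maxnn -[RHS]addn0 => /addnI.
  have [v alE] := (deg0P _).1 d0.
  by rewrite e1 alE rng_vid.
split; rewrite /= ?rng_vid // comp_vidr; split.
  by apply/ffunP => i; rewrite ffunE maxnn.
by exists (vid (src mu)), (vid (src mu)); rewrite rng_vid comp_vidr.
Qed.

End Paths.

(** * Ultrafilters of paths *)

Section Ultra.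
Context (k : nat) (L : kgraph k).
Implicit Types (lam mu nu eta : kpath L) (v w : vertex L) (U W : set (kpath L)).

Record ultra U : Prop := Ultra {
  ultra_ne : U !=set0;
  ultra_pfx : forall mu nu, U nu -> pfx mu nu -> U mu;
  ultra_dir : forall mu nu, U mu -> U nu ->
    exists lam, [/\ U lam, pfx mu lam & pfx nu lam];
  ultra_max : forall mu, U mu \/ exists2 nu, U nu & ~ compat mu nu
}.

Lemma ultra_compat U mu nu : ultra U -> U mu -> U nu -> compat mu nu.
Proof. by move=> uU m n; have [lam [_ ? ?]] := ultra_dir uU m n; exists lam. Qed.

Lemma ultra_rng U mu nu : ultra U -> U mu -> U nu -> rng mu = rng nu.
Proof.
by move=> uU m n; have [lam [/pfx_rng-> /pfx_rng->]] := ultra_compat uU m n.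
Qed.

Lemma ultra_vid U mu : ultra U -> U mu -> U (vid (rng mu)).
Proof. by move=> uU m; apply: ultra_pfx m (pfx_vid mu). Qed.

(** A path of [W] outside [U] would be incompatible with a member of [U], hence of [W]. Thanks to
    this, the equalities of ultrafilters below need only one inclusion. *)
Lemma ultra_eq U W : ultra U -> ultra W -> U `<=` W -> U = W.
Proof.
move=> uU uW sUW; apply/seteqP; split=> // mu Wmu.
have [//|[nu Unu]] := ultra_max uU mu.
by case; apply: ultra_compat Wmu (sUW _ Unu).
Qed.

(** Directedness merges finitely many witnesses of maximality into one. *)
Lemma ultra_avoid U (s : seq (kpath L)) : ultra U ->
  (forall mu, mu \in s -> ~ U mu) ->
  exists2 nu, U nu & forall mu, mu \in s -> ~ compat mu nu.
Proof.
move=> uU; elim: s => [_|mu s IH ns].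
  by have [nu Unu] := ultra_ne uU; exists nu.
have [|ze Uze hze] := IH; first by move=> q qs; apply: ns; rewrite inE qs orbT.
have [|[nu Unu nc]] := ultra_max uU mu; first by move/ns: (mem_head mu s).
have [ka [Uka zk nk]] := ultra_dir uU Uze Unu.
exists ka => // q; rewrite inE => /predU1P[->|/hze h] c.
  by apply: nc; apply: compat_pfx c => //; exact: pfx_refl.
by apply: h; apply: compat_pfx c => //; exact: pfx_refl.
Qed.

(* A generic chain: the [n]-th step goes into the [n]-th path of [L] if it can. *)
Lemma ultra_exists eta : exists2 U, ultra U & U eta.
Proof.
pose ext lam mu := xget lam [set ka | pfx lam ka /\ pfx mu ka].
have ext_l lam mu : pfx lam (ext lam mu).
  rewrite /ext; case: (xgetP lam) => [ka _ [//]|_]; exact: pfx_refl.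
have ext_r lam mu : compat lam mu -> pfx mu (ext lam mu).
  move=> [ka cka]; rewrite /ext; case: (xgetP lam) => [ka' _ [//]|] h.
  by case: (h ka).
pose h := fix h (n : nat) : kpath L := if n is m.+1 then
  (if choice.unpickle m is Some mu then ext (h m) mu else h m) else eta.
have hS n : pfx (h n) (h n.+1).
  by rewrite /=; case: choice.unpickle => [mu|]; [exact: ext_l|exact: pfx_refl].
have hle m n : (m <= n)%N -> pfx (h m) (h n).
  move=> /subnKC <-; elim: (n - m)%N => [|p IH].
    by rewrite addn0; exact: pfx_refl.
  by rewrite addnS; apply: pfx_trans IH (hS _).
exists [set mu | exists n, pfx mu (h n)]; last by exists 0%N; exact: pfx_refl.
split.
- by exists eta, 0%N; exact: pfx_refl.
- by move=> mu nu [n nn] mn; exists n; apply: pfx_trans nn.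
- move=> mu nu [m mm] [n nn]; exists (h (maxn m n)); split.
  + by exists (maxn m n); exact: pfx_refl.
  + by apply: pfx_trans mm _; apply: hle; rewrite leq_maxl.
  + by apply: pfx_trans nn _; apply: hle; rewrite leq_maxr.
(* The fate of [mu] is decided at the stage numbered by its code: either the chain absorbs it at the
   next step, or that stage is already incompatible with it. *)
- move=> mu; have [c|nc] := pselect (compat (h (choice.pickle mu)) mu).
    by left; exists (choice.pickle mu).+1; rewrite /= choice.pickleK;
      exact: ext_r.
  right; exists (h (choice.pickle mu)); last by move/compatC.
  by exists (choice.pickle mu); exact: pfx_refl.
Qed.

(** Prefixes are taken because the paths [pcomp lam eta] alone are not closed under initial
    segments. *)
Definition lact lam U : set (kpath L) :=
  [set ka | exists eta, [/\ U eta, src lam = rng eta & pfx ka (pcomp lam eta)]].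

Definition lshift lam U : set (kpath L) :=
  [set eta | src lam = rng eta /\ U (pcomp lam eta)].

Lemma lact_mem lam U eta : U eta -> src lam = rng eta -> lact lam U (pcomp lam eta).
Proof. by move=> Ue e; exists eta; split=> //; exact: pfx_refl. Qed.

Lemma lact_id lam U : U (vid (src lam)) -> lact lam U lam.
Proof.
by move=> Uv; rewrite -[X in lact _ _ X]comp_vidr; apply: lact_mem; rewrite ?rng_vid.
Qed.

Lemma ultra_src U lam eta : ultra U -> U (vid (src lam)) -> U eta ->
  src lam = rng eta.
Proof. by move=> uU Uv Ue; rewrite -(ultra_rng uU Uv Ue) rng_vid. Qed.

Hypothesis fa : finitely_aligned L.

Lemma ultra_lact lam U : ultra U -> U (vid (src lam)) -> ultra (lact lam U).
Proof.
move=> uU Uv; have srcE := ultra_src uU Uv.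
split.
- by exists lam; exact: lact_id.
- by move=> mu nu [eta [? ? p]] q; exists eta; split=> //; apply: pfx_trans p.
- move=> mu nu [eta [e ee pe]] [ze [z ez pz]].
  have [ka [Uka ek zk]] := ultra_dir uU e z.
  exists (pcomp lam ka); split; first exact/lact_mem/srcE.
    by apply: pfx_trans pe _; apply: pfx_mull.
  by apply: pfx_trans pz _; apply: pfx_mull.
- move=> mu.
  have [|nU] := pselect (exists2 p, Lmin mu lam p & U p.2).
    move=> [[al be] [/= e1 e2 E _]] /= Ube; left.
    by exists be; split=> //; rewrite -E; exact: pfx_comp.
  right.
  (* Finite alignment enters here: a single [ze] in [U] is incompatible with the second components
     of all minimal extensions, which makes [pcomp lam ze] incompatible with [mu]. *)
  have /finite_fsetP[F FE] := fa mu lam.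
  have [|ze Uze hze] := @ultra_avoid _ [seq p.2 | p <- enum_fset F] uU.
    move=> _ /mapP[p pF ->] Up; apply: nU; exists p => //.
    by rewrite FE.
  exists (pcomp lam ze); first exact/lact_mem/srcE.
  move=> [ka [mk lk]].
  have e := srcE _ Uze.
  have [p [Lp pk]] := Lmin_pfx mk (pfx_trans (pfx_comp e) lk).
  apply: (hze p.2); first by apply: map_f; move: Lp; rewrite FE.
  case: Lp => _ e2 E _; apply: (compat_mull e2 e).
  by exists ka; split=> //; rewrite -E.
Qed.

Lemma ultra_lshift lam U : ultra U -> U lam -> ultra (lshift lam U).
Proof.
move=> uU Ul.
(* By directedness the members of [U] that begin with [lam] are cofinal in [U]. *)
have up mu : U mu -> exists eta, [/\ src lam = rng eta, U (pcomp lam eta) &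
    pfx mu (pcomp lam eta)].
  move=> Um; have [ka [Uka [eta e E] mk]] := ultra_dir uU Ul Um.
  by exists eta; rewrite -E.
split.
- by exists (vid (src lam)); split; rewrite ?rng_vid ?comp_vidr.
- move=> mu nu [e Uln] mn; have e' : src lam = rng mu by rewrite e (pfx_rng mn).
  by split=> //; apply: ultra_pfx Uln _ => //; apply: pfx_mull.
- move=> mu nu [em Um] [en Un].
  have [ka [Uka mk nk]] := ultra_dir uU Um Un.
  have [eta [e Ue ke]] := up _ Uka.
  exists eta; split=> //.
    exact: pfx_mulI em e (pfx_trans mk ke).
  exact: pfx_mulI en e (pfx_trans nk ke).
- move=> mu; have [e|ne] := pselect (src lam = rng mu); last first.
    right; exists (vid (src lam)); first by split; rewrite ?rng_vid ?comp_vidr.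
    move=> [ka [/pfx_rng mk /pfx_rng]]; rewrite rng_vid => vk.
    by apply: ne; rewrite vk mk.
  have [|[nu Unu nc]] := ultra_max uU (pcomp lam mu); first by left.
  have [eta [ee Ue ne]] := up _ Unu.
  right; exists eta; first by [].
  move=> [ka [mk ek]]; apply: nc; exists (pcomp lam ka); split.
    exact: pfx_mull.
  by apply: pfx_trans ne _; apply: pfx_mull.
Qed.

Lemma lshift_vid lam U : U lam -> lshift lam U (vid (src lam)).
Proof. by move=> Ul; split; rewrite ?rng_vid ?comp_vidr. Qed.

Lemma lactK lam U : ultra U -> U (vid (src lam)) -> lshift lam (lact lam U) = U.
Proof.
move=> uU Uv; apply/esym/ultra_eq => //.
  by apply: ultra_lshift; [exact: ultra_lact|exact: lact_id].
by move=> eta Ue; have e := ultra_src uU Uv Ue; split=> //; apply: lact_mem.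
Qed.

Lemma lshiftK lam U : ultra U -> U lam -> lact lam (lshift lam U) = U.
Proof.
move=> uU Ul; apply: ultra_eq => //.
  by apply: ultra_lact; [exact: ultra_lshift|exact: lshift_vid].
by move=> ka [eta [[_ Ue] _ p]]; apply: ultra_pfx p.
Qed.

Lemma lact_comp lam mu U : ultra U -> src lam = rng mu -> U (vid (src mu)) ->
  lact (pcomp lam mu) U = lact lam (lact mu U).
Proof.
move=> uU e Uv.
have u1 := ultra_lact uU Uv.
have u2 : ultra (lact lam (lact mu U)).
  apply: ultra_lact => //; rewrite e; apply: ultra_vid => //; exact: lact_id.
apply: ultra_eq => //; first by apply: ultra_lact => //; rewrite src_comp.
move=> ka [eta [Ue]]; rewrite src_comp // => em.
rewrite -pcompA // => p; exists (pcomp mu eta); rewrite rng_comp //; split=> //.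
exact: lact_mem.
Qed.

Lemma lshift_comp lam mu U : ultra U -> src lam = rng mu -> U (pcomp lam mu) ->
  lshift (pcomp lam mu) U = lshift mu (lshift lam U).
Proof.
move=> uU e Ulm.
have Ul : U lam by apply: ultra_pfx Ulm _ => //; exact: pfx_comp.
have u1 := ultra_lshift uU Ul.
apply: ultra_eq; first exact: ultra_lshift.
  by apply: ultra_lshift.
move=> eta [ee Ue]; rewrite src_comp // in ee.
by split=> //; split; rewrite ?rng_comp // pcompA.
Qed.

Lemma lshift_id v U : ultra U -> U (vid v) -> lshift (vid v) U = U.
Proof.
move=> uU Uv; apply/esym/ultra_eq => //; first exact: ultra_lshift.
move=> eta Ue; have e := ultra_rng uU Uv Ue; rewrite rng_vid in e.
by split; rewrite ?src_vid // e comp_vidl.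
Qed.

Lemma lact_vid v U : ultra U -> U (vid v) -> lact (vid v) U = U.
Proof.
move=> uU Uv; rewrite -[in LHS](lshift_id uU Uv); exact: lshiftK.
Qed.

(** An ultrafilter missing [E] has one member incompatible with every path of [E], against
    exhaustiveness. This is the source of (KP4) in the representation. *)
Lemma ultra_FE v (E : {fset kpath L}) U : ultra U -> U (vid v) ->
  exhaustive v [set` E] -> exists2 mu, mu \in E & U mu.
Proof.
move=> uU Uv [rE exE]; apply: contrapT => nE.
have [|ze Uze hze] := @ultra_avoid _ (enum_fset E) uU.
  by move=> mu mE Um; apply: nE; exists mu.
have := ultra_rng uU Uv Uze; rewrite rng_vid => /esym /exE[mu mE].
by move/Lmin_compat/compatC; apply: hze.
Qed.

(** The pair found here indexes the one term of (KP3) that survives on [U]. *)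
Lemma lact_Lmin mu nu U : ultra U -> U (vid (src mu)) -> lact mu U nu ->
  exists2 p, Lmin mu nu p & U p.1.
Proof.
move=> uU Uv [eta [Ue e pn]].
have [p [Lp pk]] := Lmin_pfx (pfx_comp e) pn.
exists p => //; case: Lp => e1 _ _ _.
by apply: ultra_pfx Ue _ => //; apply: pfx_mulI e1 e pk.
Qed.

End Ultra.

(** * The representation on ultrafilters *)

Section LinearEndo.
Context (R : comPzRingType) (V : lmodType R).

Record lend := Lend {
  lend_fun :> V -> V;
  lendD : forall x y, lend_fun (x + y) = lend_fun x + lend_fun y;
  lendZ : forall (a : R) x, lend_fun (a *: x) = a *: lend_fun x
}.

HB.instance Definition _ := gen_eqMixin lend.
HB.instance Definition _ := gen_choiceMixin lend.

Lemma lendP (f g : lend) : f =1 g -> f = g.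
Proof.
case: f g => [f fD fZ] [g gD gZ] /= /funext fg; subst g.
by congr Lend; exact: Prop_irrelevance.
Qed.

Program Definition lend_zero := @Lend (fun=> 0) _ _.
Next Obligation. by rewrite addr0. Qed.
Next Obligation. by rewrite scaler0. Qed.

Program Definition lend_add (f g : lend) := @Lend (fun x => f x + g x) _ _.
Next Obligation. by rewrite !lendD addrACA. Qed.
Next Obligation. by rewrite !lendZ scalerDr. Qed.

Program Definition lend_scale (a : R) (f : lend) := @Lend (fun x => a *: f x) _ _.
Next Obligation. by rewrite lendD scalerDr. Qed.
Next Obligation. by rewrite lendZ !scalerA mulrC. Qed.

Program Definition lend_comp (f g : lend) := @Lend (fun x => f (g x)) _ _.
Next Obligation. by rewrite !lendD. Qed.
Next Obligation. by rewrite !lendZ. Qed.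

Definition lend_opp := lend_scale (-1).

Lemma lend_addA : associative lend_add.
Proof. by move=> f g h; apply: lendP => x; exact: addrA. Qed.

Lemma lend_addC : commutative lend_add.
Proof. by move=> f g; apply: lendP => x; exact: addrC. Qed.

Lemma lend_add0 : left_id lend_zero lend_add.
Proof. by move=> f; apply: lendP => x; exact: add0r. Qed.

Lemma lend_addN : left_inverse lend_zero lend_opp lend_add.
Proof. by move=> f; apply: lendP => x; rewrite /= scaleN1r addNr. Qed.

HB.instance Definition _ :=
  GRing.isZmodule.Build lend lend_addA lend_addC lend_add0 lend_addN.

Lemma lend_scaleA a b f : lend_scale a (lend_scale b f) = lend_scale (a * b) f.
Proof. by apply: lendP => x; exact: scalerA. Qed.

Lemma lend_scale1 : left_id 1 lend_scale.
Proof. by move=> f; apply: lendP => x; exact: scale1r. Qed.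

Lemma lend_scaleDr : right_distributive lend_scale +%R.
Proof. by move=> a f g; apply: lendP => x; exact: scalerDr. Qed.

Lemma lend_scaleDl f : {morph lend_scale^~ f : a b / a + b}.
Proof. by move=> a b; apply: lendP => x; exact: scalerDl. Qed.

HB.instance Definition _ := GRing.Zmodule_isLmodule.Build R lend
  lend_scaleA lend_scale1 lend_scaleDr lend_scaleDl.

Lemma lend_compA : associative lend_comp.
Proof. by move=> f g h; exact: lendP. Qed.

Lemma lend_compDl : left_distributive lend_comp +%R.
Proof. by move=> f g h; exact: lendP. Qed.

Lemma lend_compDr : right_distributive lend_comp +%R.
Proof. by move=> f g h; apply: lendP => x; exact: lendD. Qed.

Lemma lend_scaleAl (a : R) (f g : lend) :
  a *: lend_comp f g = lend_comp (a *: f) g.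
Proof. exact: lendP. Qed.

Lemma lend_scaleAr (a : R) (f g : lend) :
  a *: lend_comp f g = lend_comp f (a *: g).
Proof. by apply: lendP => x; rewrite /= lendZ. Qed.

HB.instance Definition _ := isNuAlgebra.Build R lend
  lend_compA lend_compDl lend_compDr lend_scaleAl lend_scaleAr.

Lemma lend_mulE (f g : lend) x : (f ** g) x = f (g x).
Proof. by []. Qed.

Lemma lend_sumE (I : Type) (r : seq I) (F : I -> lend) x :
  (\sum_(i <- r) F i) x = \sum_(i <- r) F i x.
Proof. by elim: r => [|i r IH]; rewrite ?big_nil ?big_cons // -IH. Qed.

End LinearEndo.

Section Rep.
Context (R : comPzRingType) (k : nat) (L : kgraph k).
Hypothesis fa : finitely_aligned L.
(** The cocycle shifts the integer coordinate of a point, so two paths with the same action on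
    ultrafilters can still be told apart by their values under [c]. *)
Variable c : kpath L -> int.
Hypothesis cM : forall mu nu, src mu = rng nu -> c (pcomp mu nu) = c mu + c nu.

Local Notation V := (set (kpath L) * int -> R^o).

(* The functions are defined on all sets of paths; the operators below vanish
   outside the ultrafilters. *)
Definition rep_fun mu (f : V) : V := fun x =>
  if `[< ultra x.1 /\ x.1 mu >] then f (lshift mu x.1, x.2 - c mu) else 0.

Definition rep_gfun mu (f : V) : V := fun x =>
  if `[< ultra x.1 /\ x.1 (vid (src mu)) >] then f (lact mu x.1, x.2 + c mu)
  else 0.

Program Definition rep_s mu := @Lend R V (rep_fun mu) _ _.
Next Obligation.
by apply/funext => z; rewrite /rep_fun/= !fctE /=; case: ifP; rewrite ?addr0.
Qed.
Next Obligation.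
by apply/funext => z; rewrite /rep_fun/= !fctE /=; case: ifP; rewrite ?scaler0.
Qed.

Program Definition rep_g mu := @Lend R V (rep_gfun mu) _ _.
Next Obligation.
by apply/funext => z; rewrite /rep_gfun/= !fctE /=; case: ifP; rewrite ?addr0.
Qed.
Next Obligation.
by apply/funext => z; rewrite /rep_gfun/= !fctE /=; case: ifP; rewrite ?scaler0.
Qed.

Lemma c_vid v : c (vid v) = 0.
Proof.
have e : src (vid v) = rng (vid v) by rewrite src_vid rng_vid.
have E : pcomp (vid v) (vid v) = vid v by rewrite -[X in pcomp _ (vid X)]src_vid comp_vidr.
by apply/eqP; rewrite -(addrK (c (vid v)) (c (vid v))) -cM // E subrr.
Qed.

Lemma rep_sE mu (f : V) U n : ultra U -> U mu ->
  rep_s mu f (U, n) = f (lshift mu U, n - c mu).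
Proof. by move=> uU m; rewrite /= /rep_fun asboolT. Qed.

Lemma rep_s0 mu (f : V) U n : ~ (ultra U /\ U mu) -> rep_s mu f (U, n) = 0.
Proof. by move=> h; rewrite /= /rep_fun asboolF. Qed.

Lemma rep_gE mu (f : V) U n : ultra U -> U (vid (src mu)) ->
  rep_g mu f (U, n) = f (lact mu U, n + c mu).
Proof. by move=> uU m; rewrite /= /rep_gfun asboolT. Qed.

Lemma rep_g0 mu (f : V) U n : ~ (ultra U /\ U (vid (src mu))) ->
  rep_g mu f (U, n) = 0.
Proof. by move=> h; rewrite /= /rep_gfun asboolF. Qed.

Lemma rep_vE v (f : V) U n : ultra U -> U (vid v) ->
  rep_s (vid v) f (U, n) = f (U, n).
Proof. by move=> uU m; rewrite rep_sE // lshift_id // c_vid subr0. Qed.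

Lemma rep_sgE mu (f : V) U n : ultra U -> U mu ->
  rep_s mu (rep_g mu f) (U, n) = f (U, n).
Proof.
move=> uU m; rewrite rep_sE // rep_gE; [|exact: ultra_lshift|exact: lshift_vid].
by rewrite lshiftK // subrK.
Qed.

Lemma rep_sMg mu nu (f : V) U n : ultra U -> U mu -> src mu = src nu ->
  rep_s mu (rep_g nu f) (U, n) = f (lact nu (lshift mu U), n - c mu + c nu).
Proof.
move=> uU m e; rewrite rep_sE // rep_gE //; first exact: ultra_lshift.
by rewrite -e; exact: lshift_vid.
Qed.

Lemma rep_KP0 v : rep_g (vid v) = rep_s (vid v).
Proof.
apply: lendP => f; apply/funext => -[U n].
have [[uU Uv]|h] := pselect (ultra U /\ U (vid v)).
  by rewrite rep_vE // rep_gE ?src_vid // lact_vid // c_vid addr0.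
by rewrite rep_s0 // rep_g0 // src_vid.
Qed.

Lemma rep_KP1 v w :
  rep_s (vid v) ** rep_s (vid w) = if v == w then rep_s (vid v) else 0.
Proof.
apply: lendP => f; apply/funext => -[U n]; rewrite ?lend_mulE.
have [[uU Uv]|h] := pselect (ultra U /\ U (vid v)); last first.
  by rewrite [LHS]rep_s0 //; case: eqP => // _; rewrite rep_s0.
rewrite [LHS]rep_vE //; case: eqP => [<-|ne]; first by rewrite rep_vE.
rewrite rep_s0 // => -[_ Uw]; apply: ne.
by have := ultra_rng uU Uv Uw; rewrite !rng_vid.
Qed.

Lemma rep_KP2s mu nu : src mu = rng nu ->
  rep_s mu ** rep_s nu = rep_s (pcomp mu nu).
Proof.
move=> e; apply: lendP => f; apply/funext => -[U n]; rewrite ?lend_mulE.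
have [[uU Um]|h] := pselect (ultra U /\ U mu); last first.
  rewrite [LHS]rep_s0 // [RHS]rep_s0 // => -[uU Ump]; apply: h; split=> //.
  by apply: ultra_pfx Ump _ => //; exact: pfx_comp.
rewrite [LHS]rep_sE //; have uS := ultra_lshift uU Um.
have [Umn|nU] := pselect (U (pcomp mu nu)).
  rewrite [LHS]rep_sE // [RHS]rep_sE // lshift_comp // cM //.
  by rewrite opprD addrA.
by rewrite [LHS]rep_s0 ?[RHS]rep_s0 // => -[_] // [].
Qed.

Lemma rep_KP2g mu nu : src mu = rng nu ->
  rep_g nu ** rep_g mu = rep_g (pcomp mu nu).
Proof.
move=> e; apply: lendP => f; apply/funext => -[U n]; rewrite ?lend_mulE.
have [[uU Uv]|h] := pselect (ultra U /\ U (vid (src nu))); last first.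
  by rewrite [LHS]rep_g0 // [RHS]rep_g0 // src_comp.
have uS := ultra_lact fa uU Uv.
rewrite [LHS]rep_gE // [LHS]rep_gE //; last first.
  by rewrite e; apply: ultra_vid => //; exact: lact_id.
rewrite [RHS]rep_gE //; last by rewrite src_comp.
by rewrite lact_comp // cM // addrAC addrA.
Qed.

Lemma rep_KP3 mu nu :
  rep_g mu ** rep_s nu = \sum_(p \in Lmin mu nu) (rep_s p.1 ** rep_g p.2).
Proof.
apply: lendP => f; apply/funext => -[U n]; rewrite ?lend_mulE.
rewrite fsbig_finite /=; last exact: fa.
rewrite [in RHS]lend_sumE; set s := enum_fset _.
have sP p : (p \in s) = (p \in Lmin mu nu) by rewrite /s in_fset_set //; exact: fa.
have us : uniq s by exact: fset_uniq.
have evE (r : seq (kpath L * kpath L)) (F : kpath L * kpath L -> V) z :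
  (\sum_(p <- r) F p) z = \sum_(p <- r) F p z.
  by elim: r => [|q r IH]; rewrite ?big_nil ?big_cons // -IH.
rewrite evE.
have [[uU Uv]|h] := pselect (ultra U /\ U (vid (src mu))); last first.
  rewrite [LHS]rep_g0 // big_seq big1 // => -[al be] /=.
  rewrite sP inE => -[/= e1 _ _ _]; rewrite [LHS]rep_s0 // => -[uU Ua].
  by apply: h; split=> //; rewrite e1; exact: ultra_vid.
rewrite [LHS]rep_gE //; have uA := ultra_lact fa uU Uv.
have [An|nA] := pselect (lact mu U nu); last first.
  rewrite [LHS]rep_s0; last by case.
  rewrite big_seq big1 // => -[al be] /=.
  rewrite sP inE => -[/= e1 e2 E _]; rewrite [LHS]rep_s0 // => -[_ Ua].
  by apply: nA; exists al; split=> //; rewrite E; exact: pfx_comp.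
have [[al be] Lp Ua] := lact_Lmin uU Uv An.
rewrite (bigD1_seq (al, be)) //=; last by rewrite sP inE.
rewrite big_seq_cond big1 ?addr0; last first.
  move=> [al' be'] /= /andP[]; rewrite sP inE => Lp' /eqP ne.
  rewrite [LHS]rep_s0 // => -[_ Ua'].
  have [ka [_ ak ak']] := ultra_dir uU Ua Ua'.
  by apply: ne; rewrite (Lmin_uniq Lp Lp' ak ak').
case: Lp => /= e1 e2 E _.
have uS := ultra_lshift uU Ua.
have e : src al = src be by rewrite -(src_comp e1) E src_comp.
have Sb : lshift al U (vid (src be)) by rewrite -e; exact: lshift_vid.
(* Writing [U] as [al] prepended to [lshift al U] and using that [mu] followed by [al] equals [nu]
   followed by [be], removing [nu] from [lact mu U] leaves [be] prepended to [lshift al U]. *)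
rewrite [LHS]rep_sE // [RHS]rep_sMg //; congr (f (_, _)).
  rewrite -[in LHS](lshiftK fa uU Ua) -lact_comp // -?e ?e //.
  rewrite E lact_comp // lactK //.
    exact: ultra_lact.
  by rewrite e2; apply: ultra_vid; [exact: ultra_lact|exact: lact_id].
(* The integer coordinates agree because [c mu + c al = c nu + c be]. *)
have := congr1 c E; rewrite !cM // => h.
rewrite -[c mu](addrK (c al)) h -!addrA; congr (n + _).
by rewrite [LHS]addrC -!addrA addNr addr0 addrC.
Qed.

(** Evaluated at an ultrafilter containing [v], the factor of [mu] vanishes if [mu] belongs to the
    ultrafilter and acts as the identity otherwise. Some [mu] in [E] does belong, so peeling the
    factors from the left ends in 0. *)
Lemma rep_KP4 v (E : {fset kpath L}) : FE v E ->
  \big[@nmul R (lend V) / rep_s (vid v)]_(mu <- E)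
    (rep_s (vid v) - rep_s mu ** rep_g mu) = 0.
Proof.
move=> [exE _]; apply: lendP => f; apply/funext => -[U n].
have : ultra U /\ U (vid v) -> exists2 mu, mu \in enum_fset E & U mu.
  by move=> [uU Uv]; exact: ultra_FE uU Uv exE.
have : forall mu, mu \in enum_fset E -> rng mu = v by move=> mu mE; exact: exE.1.
elim: (enum_fset E) => [_ hU|mu s IH rs hU].
  by rewrite big_nil rep_s0 // => /hU[].
rewrite big_cons lend_mulE; set P := \big[_/_]_(_ <- s) _ in IH *.
have -> (g : V) : (rep_s (vid v) - rep_s mu ** rep_g mu) g (U, n) =
    rep_s (vid v) g (U, n) - rep_s mu (rep_g mu g) (U, n).
  by rewrite /GRing.opp /= /lend_opp /= scaleN1r.
have [[uU Uv]|h] := pselect (ultra U /\ U (vid v)); last first.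
  rewrite rep_s0 // rep_s0 ?subr0 // => -[uU Um]; apply: h; split=> //.
  by rewrite -(rs mu (mem_head _ _)); exact: ultra_vid.
rewrite rep_vE //; have [Um|nUm] := pselect (U mu); first by rewrite rep_sgE // subrr.
rewrite IH ?rep_s0 ?subr0 //; first by case.
  by move=> nu ns; apply: rs; rewrite inE ns orbT.
move=> /hU[nu]; rewrite inE => /predU1P[->//|ns Un]; first by exists nu.
Qed.

Lemma rep_family : KP_family rep_s rep_g.
Proof.
split; [exact: rep_KP0|exact: rep_KP1| |exact: rep_KP3|exact: rep_KP4].
by move=> mu nu e; split; [exact: rep_KP2s|exact: rep_KP2g].
Qed.

End Rep.

(** * Generalities on the Kumjian-Pask algebra *)

Section NuAlgebraTheory.
Context (R : comPzRingType) (A : nuAlgType R).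
Implicit Types (x y z e f g h : A) (G : set A).

Lemma nmul0 x : x ** 0 = 0.
Proof. by apply: (@addrI _ (x ** 0)); rewrite -nmulDr !addr0. Qed.

Lemma nmul0l x : 0 ** x = 0.
Proof. by apply: (@addrI _ (0 ** x)); rewrite -nmulDl !addr0. Qed.

Lemma nmulNr x y : x ** (- y) = - (x ** y).
Proof. by apply: (@addrI _ (x ** y)); rewrite -nmulDr !subrr nmul0. Qed.

Lemma nmulBr x y z : x ** (y - z) = x ** y - x ** z.
Proof. by rewrite nmulDr nmulNr. Qed.

Lemma nmul_sumr (I : Type) (r : seq I) (F : I -> A) x :
  x ** (\sum_(i <- r) F i) = \sum_(i <- r) x ** F i.
Proof. by elim: r => [|i r IH]; rewrite ?big_nil ?nmul0 // !big_cons nmulDr IH. Qed.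

Lemma nmul_suml (I : Type) (r : seq I) (F : I -> A) x :
  (\sum_(i <- r) F i) ** x = \sum_(i <- r) F i ** x.
Proof. by elim: r => [|i r IH]; rewrite ?big_nil ?nmul0l // !big_cons nmulDl IH. Qed.

Inductive lspan G : A -> Prop :=
| lspan0 : lspan G 0
| lspanD x y of lspan G x & lspan G y : lspan G (x + y)
| lspanZ (a : R) x of lspan G x : lspan G (a *: x)
| lspan_gen x of G x : lspan G x.

Lemma lspan_sum G (I : eqType) (r : seq I) (F : I -> A) :
  (forall i, i \in r -> lspan G (F i)) -> lspan G (\sum_(i <- r) F i).
Proof.
move=> GF; rewrite big_seq; apply: (big_ind (lspan G)) => //.
  exact: lspan0.
exact: lspanD.
Qed.

Lemma lspan_mull G G' x : (forall y, G y -> lspan G' (x ** y)) ->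
  forall y, lspan G y -> lspan G' (x ** y).
Proof.
move=> h y; elim=> {y} [|y z _ hy _ hz|a y _ hy|y /h//].
- by rewrite nmul0; exact: lspan0.
- by rewrite nmulDr; exact: lspanD.
- by rewrite -nscaleAr; exact: lspanZ.
Qed.

Lemma lspan_mulr G G' x : (forall y, G y -> lspan G' (y ** x)) ->
  forall y, lspan G y -> lspan G' (y ** x).
Proof.
move=> h y; elim=> {y} [|y z _ hy _ hz|a y _ hy|y /h//].
- by rewrite nmul0l; exact: lspan0.
- by rewrite nmulDl; exact: lspanD.
- by rewrite -nscaleAl; exact: lspanZ.
Qed.

Lemma lspan_ideal G : (forall a x, G x -> lspan G (a ** x)) ->
  (forall a x, G x -> lspan G (x ** a)) -> two_sided_ideal (lspan G).
Proof.
move=> hl hr; split; last by move=> a; exact: lspan_mull (hl a).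
split; last by move=> x a; exact: lspan_mulr (hr a) x.
split=> [|x y hx hy]; first exact: lspan0.
by rewrite -scaleN1r; apply: lspanD => //; exact: lspanZ.
Qed.

(** The product [p = g ** h] is an idempotent below [f]. Left multiplication by [g] maps the right
    ideal of [f] onto that of [p], with inverse left multiplication by [h]; the complement is the
    right ideal of [f - p]. *)
Lemma infinite_idempotentI f g h :
  f ** f = f -> h ** g = f -> f ** g = g -> g ** f = g -> f ** h = h ->
  h ** f = h -> g ** h <> f -> infinite_idempotent f.
Proof.
move=> ff hg fg gf fh hf ne; split=> //.
have [p pE] : exists p, p = g ** h by eexists.
have fp : f ** p = p by rewrite pE nmulA fg.
have pf : p ** f = p by rewrite pE -nmulA hf.
have pp : p ** p = p by rewrite [in LHS]pE nmulA -[g ** h ** g]nmulA hg gf.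
have rI (e : A) : right_ideal (principal_right e).
  split; first split; first by exists 0; rewrite ?nmul0.
    by move=> _ _ [x _ <-] [y _ <-]; exists (x - y); rewrite ?nmulBr.
  by move=> _ a [x _ <-]; exists (x ** a); rewrite ?nmulA.
exists (principal_right p); split.
- split=> //; exists (principal_right (f - p)); split=> //.
    apply/seteqP; split=> [_ [x _ <-]|_ [_ [x _ <-] [_ [y _ <-] <-]]].
      exists (p ** x); first by exists x.
      exists ((f - p) ** x); first by exists x.
      by rewrite -nmulDl addrC subrK.
    exists (p ** x + (f - p) ** y) => //.
    by rewrite nmulDr !nmulA nmulBr ff fp.
  apply/seteqP; split=> [z [[x _ <-] [y _ E]]|_ ->]; last first.
    by split; exists 0; rewrite ?nmul0.
  by rewrite /= -[p in LHS]pp -nmulA -E nmulA nmulBr pf pp subrr nmul0l.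
(* If the two ideals coincide then [f = p ** x] for some [x], so [p = p ** f = p ** p ** x = f]. *)
- move=> E; apply: ne; rewrite -pE; have : principal_right p f by rewrite E; exists f.
  by move=> [x _ E']; rewrite -[LHS]pf -[in LHS]E' nmulA pp.
- exists (fun y => g ** y); split.
  + by move=> x y _ _; rewrite nmulDr.
  + by move=> x a _; rewrite nmulA.
  split.
  + move=> _ [x _ <-]; exists (g ** x) => //.
    by rewrite pE !nmulA -[g ** h ** g]nmulA hg.
  + move=> x y; rewrite !inE => -[x' _ <-] [y' _ <-] /(congr1 (nmul h)).
    by rewrite !nmulA hg ff.
  + move=> _ [x _ <-]; exists (h ** x); last by rewrite pE nmulA.
    by exists (h ** x); rewrite // nmulA fh.
Qed.

End NuAlgebraTheory.

(** * Relations between the generators, and the spanning monomials *)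

Section KPRelations.
Context (R : comPzRingType) (k : nat) (L : kgraph k).
Hypothesis fa : finitely_aligned L.
Implicit Types (lam mu nu rho sig eta al be : kpath L) (v w : vertex L).
Local Notation A := (KP R L).
Local Notation s := (@kp_s R k L).
Local Notation sg := (@kp_sg R k L).

Lemma kp_ind (P : A -> Prop) :
  (forall mu, P (s mu)) -> (forall mu, P (sg mu)) -> P 0 ->
  (forall x y, P x -> P y -> P (x + y)) ->
  (forall a x, P x -> P (a *: x)) ->
  (forall x y, P x -> P y -> P (x ** y)) -> forall x, P x.
Proof.
move=> Ps Pg P0 PD PZ PM x; rewrite -[x]reprK -/(kp_class _).
elim: (repr x) => [mu|mu||t IHt u IHu|a t IHt|t IHt u IHu].
- exact: Ps.
- exact: Pg.
- exact: P0.
- have -> : kp_class (TAdd t u) = kp_class t + kp_class u.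
    by apply: kp_ext => C T Tg famT; rewrite kp_liftD // !kp_liftE.
  exact: PD.
- have -> : kp_class (TScale a t) = a *: kp_class t.
    by apply: kp_ext => C T Tg famT; rewrite kp_liftZ // !kp_liftE.
  exact: PZ.
- have -> : kp_class (TMul t u) = kp_class t ** kp_class u.
    by apply: kp_ext => C T Tg famT; rewrite kp_liftM // !kp_liftE.
  exact: PM.
Qed.

Let fam : KP_family s sg := kp_family R fa.

Lemma kp_sgv v : sg (vid v) = s (vid v).
Proof. exact: KP0 fam v. Qed.

Lemma kp_ss mu nu : src mu = rng nu -> s mu ** s nu = s (pcomp mu nu).
Proof. by move=> /(KP2 fam)[]. Qed.

Lemma kp_gg mu nu : src mu = rng nu -> sg nu ** sg mu = sg (pcomp mu nu).
Proof. by move=> /(KP2 fam)[]. Qed.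

Lemma kp_vv v : s (vid v) ** s (vid v) = s (vid v).
Proof. by rewrite (KP1 fam) eqxx. Qed.

Lemma kp_vs mu : s (vid (rng mu)) ** s mu = s mu.
Proof. by rewrite kp_ss ?src_vid // comp_vidl. Qed.

Lemma kp_sv mu : s mu ** s (vid (src mu)) = s mu.
Proof. by rewrite kp_ss ?rng_vid // comp_vidr. Qed.

Lemma kp_vg mu : s (vid (src mu)) ** sg mu = sg mu.
Proof. by rewrite -kp_sgv kp_gg ?rng_vid // comp_vidr. Qed.

Lemma kp_gv mu : sg mu ** s (vid (rng mu)) = sg mu.
Proof. by rewrite -kp_sgv kp_gg ?src_vid // comp_vidl. Qed.

Lemma kp_gs mu : sg mu ** s mu = s (vid (src mu)).
Proof. by rewrite (KP3 fam) Lmin_refl fsbig_set1 /= kp_sgv kp_vv. Qed.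

Lemma kp_gs0 mu nu : ~ compat mu nu -> sg mu ** s nu = 0.
Proof.
move=> nc; rewrite (KP3 fam) fsbig1 // => p Lp.
by case: nc; apply/Lmin_compat; exists p.
Qed.

Lemma kp_gs_l mu al : src mu = rng al -> sg mu ** s (pcomp mu al) = s al.
Proof. by move=> e; rewrite -kp_ss // nmulA kp_gs e kp_vs. Qed.

Lemma kp_gs_r mu al : src mu = rng al -> sg (pcomp mu al) ** s mu = sg al.
Proof. by move=> e; rewrite -kp_gg // -nmulA kp_gs e kp_gv. Qed.

Lemma kp_vs0 v mu : v <> rng mu -> s (vid v) ** s mu = 0.
Proof.
by move=> ne; rewrite -(kp_vs mu) nmulA (KP1 fam); case: eqP => // _; rewrite nmul0l.
Qed.

Lemma kp_gv0 mu v : v <> rng mu -> sg mu ** s (vid v) = 0.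
Proof.
move=> ne; rewrite -(kp_gv mu) -nmulA (KP1 fam); case: eqP => [/esym//|_].
by rewrite nmul0.
Qed.

Definition kp_mono : set A :=
  [set x | exists mu nu, src mu = src nu /\ x = s mu ** sg nu].

(** (KP3) rewrites the inner ghost-path product as a sum of path-ghost products, which the outer
    factors absorb. *)
Lemma kp_monoM x y : kp_mono x -> kp_mono y -> lspan kp_mono (x ** y).
Proof.
move=> [mu [nu [e ->]]] [al [be [e' ->]]].
rewrite -nmulA [sg nu ** _]nmulA (KP3 fam) fsbig_finite /=; last exact: fa.
rewrite nmul_suml nmul_sumr; apply: lspan_sum => -[ga de].
rewrite in_fset_set; last exact: fa.
rewrite inE => -[/= e1 e2 E _]; apply: lspan_gen.
exists (pcomp mu ga), (pcomp be de); split.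
  rewrite !src_comp ?e -?e' //.
  by rewrite -(src_comp e1) E src_comp.
by rewrite -kp_ss ?e // -kp_gg -?e' // !nmulA.
Qed.

Lemma kp_span x : lspan kp_mono x.
Proof.
elim/kp_ind: x => [mu|mu||x y||x y hx hy].
- apply: lspan_gen; exists mu, (vid (src mu)).
  by rewrite src_vid kp_sgv kp_sv.
- apply: lspan_gen; exists (vid (src mu)), mu.
  by rewrite src_vid kp_vg.
- exact: lspan0.
- exact: lspanD.
- exact: lspanZ.
- apply: lspan_mull hy => z mz; apply: lspan_mulr hx => t mt.
  exact: kp_monoM.
Qed.

End KPRelations.

(** * Consequences of simplicity *)

Section Simple.
Context (R : comPzRingType) (k : nat) (L : kgraph k).
Hypothesis fa : finitely_aligned L.
Hypothesis simple : simple_ring (KP R L).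
Implicit Types (lam mu nu rho sig eta al be : kpath L) (v w : vertex L).
Local Notation A := (KP R L).
Local Notation s := (@kp_s R k L).
Local Notation sg := (@kp_sg R k L).
Local Notation V := (set (kpath L) * int -> R^o).

Lemma ideal_full (I : set A) x :
  two_sided_ideal I -> I x -> x <> 0 -> forall y, I y.
Proof. by move=> /simple.2 [->//|->]. Qed.

Lemma one_neq0 : (1 : R) <> 0.
Proof.
by have [x /eqP x0] := simple.1 => e; apply: x0; rewrite -[x]scale1r e scale0r.
Qed.

(** Without paths there are no generators, so the algebra would be zero. *)
Lemma path_exists : exists mu : kpath L, True.
Proof.
apply: contrapT => no; have [x /eqP] := simple.1; case.
elim/kp_ind: x => [mu|mu||x y -> ->|a x ->|x y -> ->].
- by case: no; exists mu.
- by case: no; exists mu.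
- by [].
- by rewrite addr0.
- by rewrite scaler0.
- by rewrite nmul0.
Qed.

(** The kernel is a two-sided ideal; a nonzero element in it would force it to contain [kp_s mu]. *)
Lemma kp_lift_inj (B : nuAlgType R) (S Sg : kpath L -> B) mu x :
  KP_family S Sg -> S mu <> 0 -> kp_lift S Sg x = 0 -> x = 0.
Proof.
move=> f Smu lx; apply: contrapT => x0.
have hom := kp_lift_hom f; have [hD hZ hM] := hom.
apply: Smu; rewrite -[S mu](kp_liftE (TGen mu) f).
apply: (@ideal_full [set y | kp_lift S Sg y = 0] x) => //.
split; last by move=> a y /= e; rewrite hM e nmul0.
split; last by move=> y a /= e; rewrite hM e nmul0l.
split; first exact: nualg_hom0 hom.
by move=> y z /= ey ez; rewrite (nualg_homB _ _ hom) ey ez subr0.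
Qed.

Section Twist.
Variable c : kpath L -> int.
Hypothesis cM : forall mu nu, src mu = rng nu -> c (pcomp mu nu) = c mu + c nu.

Definition rep : A -> lend V :=
  kp_lift (rep_s R c) (rep_g R c).

Let fam : KP_family (rep_s R c) (rep_g R c) := rep_family R fa cM.

Lemma rep_hom : nualg_hom rep.
Proof. exact: kp_lift_hom fam. Qed.

Lemma rep_sS mu : rep (s mu) = rep_s R c mu.
Proof. exact: (kp_liftE (TGen mu) fam). Qed.

Lemma rep_gS mu : rep (sg mu) = rep_g R c mu.
Proof. exact: (kp_liftE (TGhost mu) fam). Qed.

Lemma rep_vid_scale (a : R) v : a *: rep_s R c (vid v) = 0 -> a = 0.
Proof.
have [U uU Uv] := ultra_exists (vid v).
move=> /(congr1 (fun T : lend V => T (fun=> 1) (U, 0))) /= h.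
transitivity (a *: (rep_s R c (vid v) (fun=> 1) (U, 0))); last exact: h.
by rewrite rep_vE // /GRing.scale /= mulr1.
Qed.

Lemma rep_inj x : rep x = 0 -> x = 0.
Proof.
have [mu _] := path_exists.
apply: (@kp_lift_inj _ _ _ (vid (src mu))) => // e.
by apply: one_neq0; apply: (@rep_vid_scale 1 (src mu)); rewrite e scaler0.
Qed.

Lemma rep_nonultra x f U n : ~ ultra U -> rep x f (U, n) = 0.
Proof.
move=> nU; have [hD hZ hM] := rep_hom.
elim/kp_ind: x f => [mu|mu||x y hx hy|a x hx|x y hx hy] f.
- by rewrite rep_sS rep_s0 // => -[].
- by rewrite rep_gS rep_g0 // => -[].
- by rewrite (nualg_hom0 rep_hom).
- by rewrite hD -[LHS]/(rep x f (U, n) + rep y f (U, n)) hx hy addr0.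
- by rewrite hZ -[LHS]/(a *: rep x f (U, n)) hx scaler0.
- by rewrite hM lend_mulE hx.
Qed.

End Twist.

Let c0 : kpath L -> int := fun=> 0.
Let c0M mu nu : src mu = rng nu -> c0 (pcomp mu nu) = c0 mu + c0 nu.
Proof. by rewrite /c0 addr0. Qed.

Lemma kp_scale_vid (a : R) v : a *: s (vid v) = 0 -> a = 0.
Proof.
move=> e; apply: (@rep_vid_scale c0 c0M _ v).
have [_ hZ _] := rep_hom c0M.
by rewrite -rep_sS // -hZ e (nualg_hom0 (rep_hom c0M)).
Qed.

Lemma kp_vid_neq0 v : s (vid v) <> 0.
Proof.
by move=> e; apply: one_neq0; apply: (@kp_scale_vid _ v); rewrite e scaler0.
Qed.

Lemma aperiodic rho sig : src rho = src sig -> rho <> sig ->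
  exists2 eta, src rho = rng eta & ~ compat (pcomp rho eta) (pcomp sig eta).
Proof.
move=> e ne; apply: contrapT => no.
have per eta : src rho = rng eta -> compat (pcomp rho eta) (pcomp sig eta).
  by move=> ee; apply: contrapT => nc; apply: no; exists eta.
(* Taking [eta] to be the common source shows [rho] and [sig] compatible, and compatible paths of
   equal degree are equal. *)
have dne : deg rho <> deg sig.
  have := per (vid (src rho)); rewrite rng_vid comp_vidr e comp_vidr => /(_ erefl).
  by move=> [lam [rl sl]] d; apply: ne; apply: pfx_uniq rl sl d.
(* If a member of [lact rho U] were incompatible with one of [lact sig U], a common extension [th]
   in [U] of the two tails would contradict [per th]. *)
have actE U : ultra U -> U (vid (src rho)) -> lact rho U = lact sig U.
  move=> uU Uv; have Uv' : U (vid (src sig)) by rewrite -e.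
  have u1 := ultra_lact fa uU Uv; have u2 := ultra_lact fa uU Uv'.
  apply: ultra_eq => // ka Rka.
  have [//|[ze [eta' [U' e' p']] nc]] := ultra_max u2 ka.
  case: Rka => eta [U1 e1 p1].
  have [th [Uth p q]] := ultra_dir uU U1 U'.
  have eth := ultra_src uU Uv Uth.
  case: nc; apply: compat_pfx (per th eth).
    by apply: pfx_trans p1 _; apply: pfx_mull.
  by apply: pfx_trans p' _; apply: pfx_mull.
have gE : sg rho = sg sig.
  apply: subr0_eq; apply: (@rep_inj c0 c0M).
  rewrite (nualg_homB _ _ (rep_hom c0M)) !rep_gS //.
  suff -> : rep_g R c0 rho = rep_g R c0 sig by rewrite subrr.
  apply: lendP => f; apply/funext => -[U n].
  have [[uU Uv]|h] := pselect (ultra U /\ U (vid (src rho))).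
    by rewrite !rep_gE -?e // actE.
  by rewrite !rep_g0 -?e.
have [i di] : exists i, deg rho i <> deg sig i.
  apply: contrapT => ni; apply: dne; apply/ffunP => i.
  by apply: contrapT => di; apply: ni; exists i.
pose c mu : int := (deg mu i)%:Z.
have cM mu nu : src mu = rng nu -> c (pcomp mu nu) = c mu + c nu.
  by move=> h; rewrite /c deg_comp // ffunE.
have [U uU Uv] := ultra_exists (vid (src rho)).
have := congr1 (rep c) gE; rewrite !rep_gS //.
(* The test function is the indicator of the integer coordinate [c rho]: at [(U, 0)] the ghost of
   [rho] gives 1 and that of [sig] gives 0. *)
move=> /(congr1 (fun T : lend V => T (fun x => (x.2 == c rho)%:R) (U, 0))) /=.
have Uv' : U (vid (src sig)) by rewrite -e.
rewrite -[LHS]/(rep_g R c rho _ (U, 0)) -[RHS]/(rep_g R c sig _ (U, 0)).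
rewrite !rep_gE //= !add0r eqxx; case: eqP => [[/esym/di//]|_].
exact: one_neq0.
Qed.

(** Far enough along [U], the ghost of [ka] turns each monomial of [x] into a ghost or kills it: its
    path part either lies in [U], and is cancelled by [ka], or is incompatible with a member of [U].
    Quantifying over all longer [ka] lets directedness combine the terms of a sum. *)
Lemma kp_ghost_span x U : ultra U -> exists2 mu, U mu & forall ka, U ka ->
  pfx mu ka ->
  lspan [set sg rho | rho in [set rho | src rho = src ka]] (sg ka ** x).
Proof.
move=> uU; elim: (kp_span fa x) => {x}
  [|x y _ [m Um hm] _ [n Un hn]|a x _ [m Um hm]|].
- have [mu Umu] := ultra_ne uU; exists mu => // ka _ _.
  by rewrite nmul0; exact: lspan0.
- have [ze [Uz mz nz]] := ultra_dir uU Um Un.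
  exists ze => // ka Uk zk; rewrite nmulDr; apply: lspanD.
    by apply: hm => //; apply: pfx_trans mz zk.
  by apply: hn => //; apply: pfx_trans nz zk.
- exists m => // ka Uk mk; rewrite -nscaleAr; apply: lspanZ; exact: hm.
- move=> _ [mu [nu [e ->]]].
  have [Um|[ze Uz nc]] := ultra_max uU mu.
    exists mu => // ka Uk [al e1 ->]; rewrite nmulA kp_gs_r // kp_gg -?e //.
    by apply: lspan_gen; exists (pcomp nu al); rewrite //= !src_comp -?e.
  exists ze => // ka Uk zk; rewrite nmulA kp_gs0 ?nmul0l //; first exact: lspan0.
  by move=> c; apply: nc; apply/compatC; apply: compat_pfx c => //; exact: pfx_refl.
Qed.

(** The ultrafilter is one on which [x] acts nontrivially; then [sg mu ** x] acts nontrivially at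
    its shift by [mu], hence is nonzero. *)
Lemma kp_ghost_part x : x <> 0 -> exists mu,
  sg mu ** x <> 0 /\
  lspan [set sg rho | rho in [set rho | src rho = src mu]] (sg mu ** x).
Proof.
move=> x0; have [f [U [n ne]]] : exists f U n, rep c0 x f (U, n) <> 0.
  apply: contrapT => no; apply: x0; apply: (rep_inj c0M).
  apply: lendP => f; apply/funext => -[U n].
  by apply: contrapT => ne; apply: no; exists f, U, n.
have uU : ultra U by apply: contrapT => nU; apply: ne; exact: rep_nonultra.
have [mu Um h] := kp_ghost_span x uU.
exists mu; split; last by apply: h => //; exact: pfx_refl.
move=> e; apply: ne; have [_ _ hM] := rep_hom c0M.
have uS := ultra_lshift uU Um; have Sv := lshift_vid Um.
have : rep c0 (sg mu ** x) f (lshift mu U, n) = 0.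
  by rewrite e (nualg_hom0 (rep_hom c0M)).
by rewrite hM lend_mulE rep_gS // rep_gE // lshiftK // addr0.
Qed.

(** Distinct indices allow one term to be isolated later; two sums are added after padding both with
    zero coefficients to a common index list. *)
Lemma lspan_uniq_sum (P : set (kpath L)) (F : kpath L -> A) x :
  lspan [set F rho | rho in P] x ->
  exists (r : kpath L -> R) (l : seq (kpath L)),
    [/\ uniq l, forall rho, rho \in l -> P rho &
        x = \sum_(rho <- l) r rho *: F rho].
Proof.
have widen (r : kpath L -> R) (l t : seq (kpath L)) :
  uniq l -> uniq t -> {subset l <= t} ->
  \sum_(rho <- l) r rho *: F rho =
  \sum_(rho <- t) (if rho \in l then r rho else 0) *: F rho.
  move=> ul ut lt.
  transitivity (\sum_(rho <- t | rho \in l) r rho *: F rho).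
    rewrite -[RHS]big_filter; apply: perm_big; apply: uniq_perm => //.
      exact: filter_uniq.
    by move=> rho; rewrite mem_filter; case: (boolP (rho \in l)) => // /lt ->.
  by rewrite big_mkcond; apply: eq_bigr => rho _; case: ifP; rewrite ?scale0r.
elim=> {x}
  [|x y _ [r1 [l1 [u1 P1 ->]]] _ [r2 [l2 [u2 P2 ->]]]|a x _ [r [l [u P1 ->]]]|].
- by exists (fun=> 0), [::]; rewrite big_nil.
- exists (fun rho => (if rho \in l1 then r1 rho else 0) +
                     (if rho \in l2 then r2 rho else 0)), (undup (l1 ++ l2)).
  split; first exact: undup_uniq.
    by move=> rho; rewrite mem_undup mem_cat => /orP[/P1|/P2].
  rewrite (widen r1 l1 (undup (l1 ++ l2))) ?undup_uniq //; last first.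
    by move=> rho h; rewrite mem_undup mem_cat h.
  rewrite (widen r2 l2 (undup (l1 ++ l2))) ?undup_uniq //; last first.
    by move=> rho h; rewrite mem_undup mem_cat h orbT.
  by rewrite -big_split; apply: eq_bigr => rho _; rewrite scalerDl.
- exists (fun rho => a * r rho), l; split=> //.
  by rewrite scaler_sumr; apply: eq_bigr => rho _; rewrite scalerA.
- move=> _ [rho Prho <-]; exists (fun=> 1), [:: rho]; split=> //.
    by move=> sig; rewrite inE => /eqP->.
  by rewrite big_seq1 scale1r.
Qed.

(** Aperiodicity is applied to one path at a time, lengthening [eta]; incompatibilities already
    obtained survive further extension. *)
Lemma aperiodic_seq rho (l : seq (kpath L)) :
  (forall sig, sig \in l -> src sig = src rho) ->
  exists2 eta, src rho = rng eta & forall sig, sig \in l -> sig <> rho ->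
    ~ compat (pcomp sig eta) (pcomp rho eta).
Proof.
elim: l => [_|sig l IH sl].
  by exists (vid (src rho)); rewrite ?rng_vid.
have [|eta e h] := IH; first by move=> t tl; apply: sl; rewrite inE tl orbT.
have es : src sig = src rho by apply: sl; rewrite mem_head.
have [->|ne] := pselect (sig = rho).
  by exists eta => // t; rewrite inE => /predU1P[->|/h].
have [||ze] := @aperiodic (pcomp sig eta) (pcomp rho eta).
- by rewrite !src_comp ?es.
(* Right cancellation: equal composites with the same tail [eta] have first factors of equal degree,
   hence equal. *)
- move=> E; apply: ne.
  have [] // := pcomp_inj (etrans es e) e E.
  have := congr1 (@deg _ _) E; rewrite !deg_comp ?es // => /ffunP d.
  by apply/ffunP => i; have := d i; rewrite !ffunE => /addIn.
rewrite src_comp ?es // => ez nc; exists (pcomp eta ze).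
  by rewrite rng_comp.
move=> t; rewrite inE => /predU1P[-> _|tl tne].
  by rewrite !pcompA ?es.
have et : src t = src rho by apply: sl; rewrite inE tl orbT.
move=> cc; apply: (h t tl tne); apply: compat_pfx cc.
  by apply: pfx_mull; rewrite ?et //; exact: pfx_comp.
by apply: pfx_mull => //; exact: pfx_comp.
Qed.

Lemma kp_vertex_factor x : x <> 0 -> exists a b v, a ** x ** b = s (vid v).
Proof.
move=> /kp_ghost_part [mu [ne]]; set y := sg mu ** x in ne *.
move=> /lspan_uniq_sum [r [l [ul lP yE]]].
have [rho rl r0] : exists2 rho, rho \in l & r rho <> 0.
  apply: contrapT => no; apply: ne; rewrite yE big_seq big1 // => rho rl.
  suff -> : r rho = 0 by rewrite scale0r.
  by apply: contrapT => h; apply: no; exists rho.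
have [|eta e h] := @aperiodic_seq rho l.
  by move=> sig sl; rewrite (lP _ rl) (lP _ sl).
(* The compression turns the ghost of [sig] into the product of the ghost of [pcomp sig eta] with
   the path [pcomp rho eta], which is 0 for every [sig] in [l] other than [rho]. *)
have E : sg eta ** y ** s (pcomp rho eta) = r rho *: s (vid (src eta)).
  rewrite yE nmul_sumr nmul_suml (bigD1_seq rho) //= big_seq_cond big1 ?addr0.
    by rewrite -nscaleAr -nscaleAl kp_gg // kp_gs // src_comp.
  move=> sig /andP[sl /eqP ns]; rewrite -nscaleAr -nscaleAl.
  rewrite (kp_gg _ fa); last by rewrite (lP _ sl) -(lP _ rl).
  by rewrite kp_gs0 ?scaler0 //; exact: h.
(* The multiples of the scalar form a nonzero ideal, so the vertex idempotent is itself such a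
   multiple, and [d] plays the role of the inverse scalar. *)
pose I := [set z | exists d : A, z = r rho *: d].
have [d dE] : I (s (vid (src eta))).
  apply: (@ideal_full I (r rho *: s (vid (src eta)))).
  - split; last by move=> a _ [d ->]; exists (a ** d); rewrite nscaleAr.
    split; last by move=> _ a [d ->]; exists (d ** a); rewrite nscaleAl.
    split; first by exists 0; rewrite scaler0.
    by move=> _ _ [d ->] [d' ->]; exists (d - d'); rewrite scalerBr.
  - by exists (s (vid (src eta))).
  - by move/kp_scale_vid.
exists (sg eta ** sg mu), (s (pcomp rho eta) ** d), (src eta).
have -> : sg eta ** sg mu ** x = sg eta ** y by rewrite -nmulA.
rewrite nmulA E -nscaleAl nscaleAr -dE.
exact: kp_vv.
Qed.

Lemma vle_refl v : vle v v.
Proof. by exists (vid v); rewrite rng_vid src_vid. Qed.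

Lemma vle_trans u v w : vle u v -> vle v w -> vle u w.
Proof.
move=> [lam [r1 s1]] [mu [r2 s2]]; exists (pcomp lam mu).
by rewrite rng_comp ?src_comp ?s1 ?r2.
Qed.

Lemma kp_vertex_span v (x : A) :
  lspan [set y | exists a b, y = a ** s (vid v) ** b] x.
Proof.
set G := [set y | _].
apply: (@ideal_full (lspan G) (s (vid v))).
- apply: lspan_ideal => a _ [b [d ->]]; apply: lspan_gen.
    by exists (a ** b), d; rewrite !nmulA.
  by exists b, (d ** a); rewrite !nmulA.
- by apply: lspan_gen; exists (s (vid v)), (s (vid v)); rewrite !kp_vv.
- exact: kp_vid_neq0.
Qed.

(** A monomial surviving between [w] and [v] has its paths starting at [w] and [v] and a common
    source, which is an upper bound. If there is none, everything between [w] and [v] vanishes;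
    since [v] generates the whole algebra as an ideal, [w] kills it all, including itself. *)
Lemma vle_directed v w : exists u, vle v u /\ vle w u.
Proof.
apply: contrapT => no; apply: (@kp_vid_neq0 w).
have z a : s (vid w) ** a ** s (vid v) = 0.
  elim: (kp_span fa a) => {a} [|x y _ hx _ hy|c x _ hx|_ [mu [nu [e ->]]]].
  - by rewrite nmul0 nmul0l.
  - by rewrite nmulDr nmulDl hx hy addr0.
  - by rewrite -nscaleAr -nscaleAl hx scaler0.
  have [ev|ne] := pselect (v = rng nu); last first.
    by rewrite nmulA -nmulA kp_gv0 // nmul0.
  have [ew|ne] := pselect (w = rng mu); last first.
    by rewrite nmulA kp_vs0 // !nmul0l.
  case: no; exists (src mu); split; last by exists mu.
  by exists nu.
rewrite -kp_vv //.
suff h x : s (vid w) ** x = 0 by exact: h.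
elim: (kp_vertex_span v x) => {x} [|x y _ hx _ hy|c x _ hx|_ [a [b ->]]].
- by rewrite nmul0.
- by rewrite nmulDr hx hy addr0.
- by rewrite -nscaleAr hx scaler0.
- by rewrite !nmulA z nmul0l.
Qed.

End Simple.

(** * Terminal vertices *)

Section Sink.
Context (R : comPzRingType) (k : nat) (L : kgraph k).
Hypothesis fa : finitely_aligned L.
Hypothesis simple : simple_ring (KP R L).
Implicit Types (lam mu nu rho sig eta al be : kpath L) (v w : vertex L).
Implicit Types (l : seq (kpath L)).
Local Notation A := (KP R L).
Local Notation s := (@kp_s R k L).
Local Notation sg := (@kp_sg R k L).

Variable u : vertex L.
Hypothesis sink : forall lam, rng lam = u -> lam = vid u.

Lemma sink_pfx mu lam : src mu = u -> pfx mu lam -> lam = mu.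
Proof. by move=> e [al ea ->]; rewrite (@sink al) -?ea // -e comp_vidr. Qed.

Lemma kp_gs_sink mu nu : src mu = u -> src nu = u ->
  sg mu ** s nu = if mu == nu then s (vid u) else 0.
Proof.
move=> em en; case: eqP => [<-|ne]; first by rewrite kp_gs // em.
apply: kp_gs0 => // -[lam [ml nl]]; apply: ne.
by rewrite -(sink_pfx em ml) (sink_pfx en nl).
Qed.

Definition sink_unit : set A :=
  [set x | exists mu nu, [/\ src mu = u, src nu = u & x = s mu ** sg nu]].

(** The span of these matrix units is an ideal containing the idempotent of [u]. A path ending at
    [u] has no proper extension, so multiplying by a monomial either gives 0 or replaces one path
    ending at [u] by another. *)
Lemma sink_span x : lspan sink_unit x.
Proof.
apply: (@ideal_full _ _ _ simple (lspan sink_unit) (s (vid u))).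
- apply: lspan_ideal => a _ [mu [nu [em en ->]]].
    elim: (kp_span fa a) => {a} [|y z _ hy _ hz|c y _ hy|_ [al [be [e ->]]]].
    + by rewrite nmul0l; exact: lspan0.
    + by rewrite nmulDl; exact: lspanD.
    + by rewrite -nscaleAl; exact: lspanZ.
    rewrite nmulA -[s al ** sg be ** _]nmulA.
    have [[lam [bl ml]]|nc] := pselect (compat be mu); last first.
      by rewrite kp_gs0 // nmul0 nmul0l; exact: lspan0.
    move: bl; rewrite (sink_pfx em ml) => -[ga eg E].
    have eu : src ga = u by rewrite -em E src_comp.
    rewrite E kp_gs_l // kp_ss ?e //; apply: lspan_gen.
    by exists (pcomp al ga), nu; rewrite src_comp ?e.
  elim: (kp_span fa a) => {a} [|y z _ hy _ hz|c y _ hy|_ [al [be [e ->]]]].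
  + by rewrite nmul0; exact: lspan0.
  + by rewrite nmulDr; exact: lspanD.
  + by rewrite -nscaleAr; exact: lspanZ.
  rewrite nmulA -[s mu ** sg nu ** _]nmulA.
  have [[lam [nl al']]|nc] := pselect (compat nu al); last first.
    by rewrite kp_gs0 // nmul0 nmul0l; exact: lspan0.
  move: al'; rewrite (sink_pfx en nl) => -[ga eg E].
  have eu : src ga = u by rewrite -en E src_comp.
  rewrite E kp_gs_r // -nmulA kp_gg -?e //; apply: lspan_gen.
  by exists mu, (pcomp be ga); rewrite src_comp -?e.
- apply: lspan_gen; exists (vid u), (vid u).
  by rewrite src_vid kp_sgv // kp_vv.
- exact: kp_vid_neq0.
Qed.

(** A matrix unit survives only if both its paths have range [u], and then both are [u]. These
    scalars become the matrix entries. *)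
Lemma sink_corner x : exists r : R, s (vid u) ** x ** s (vid u) = r *: s (vid u).
Proof.
elim: (sink_span x) => {x}
  [|x y _ [a ha] _ [b hb]|c x _ [a ha]|_ [mu [nu [em en ->]]]].
- by exists 0; rewrite nmul0 nmul0l scale0r.
- by exists (a + b); rewrite nmulDr nmulDl ha hb scalerDl.
- by exists (c * a); rewrite -nscaleAr -nscaleAl ha scalerA.
have [rm|ne] := pselect (u = rng mu); last first.
  by exists 0; rewrite nmulA kp_vs0 // !nmul0l scale0r.
have [rn|ne] := pselect (u = rng nu); last first.
  by exists 0; rewrite -!nmulA kp_gv0 // !nmul0 scale0r.
exists 1; rewrite (sink (esym rm)) (sink (esym rn)) kp_sgv // !kp_vv //.
by rewrite scale1r.
Qed.

Definition sink_proj l : A := \sum_(mu <- l) s mu ** sg mu.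

Definition sink_seq l := uniq l /\ forall mu, mu \in l -> src mu = u.

Lemma sink_projl l mu : sink_seq l -> src mu = u ->
  sink_proj l ** s mu = if mu \in l then s mu else 0.
Proof.
move=> [ul lu] em; rewrite /sink_proj nmul_suml.
case: ifP => [ml|/negP nl]; last first.
  rewrite big_seq big1 // => nu nul; rewrite -nmulA (kp_gs_sink (lu _ nul) em).
  by case: eqP => [E|_]; rewrite ?nmul0 //; case: nl; rewrite -E.
rewrite (bigD1_seq mu) //= big_seq_cond big1 ?addr0.
  by rewrite -nmulA kp_gs_sink // eqxx -em kp_sv.
move=> nu /andP[nul /negPf ne]; rewrite -nmulA (kp_gs_sink (lu _ nul) em).
by rewrite ne nmul0.
Qed.

Lemma sink_projr l mu : sink_seq l -> src mu = u ->
  sg mu ** sink_proj l = if mu \in l then sg mu else 0.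
Proof.
move=> [ul lu] em; rewrite /sink_proj nmul_sumr.
case: ifP => [ml|/negP nl]; last first.
  rewrite big_seq big1 // => nu nul; rewrite nmulA (kp_gs_sink em (lu _ nul)).
  by case: eqP => [E|_]; rewrite ?nmul0l //; case: nl; rewrite E.
rewrite (bigD1_seq mu) //= big_seq_cond big1 ?addr0.
  by rewrite nmulA kp_gs_sink // eqxx -em kp_vg.
move=> nu /andP[nul /negPf ne]; rewrite nmulA (kp_gs_sink em (lu _ nul)).
by rewrite eq_sym ne nmul0l.
Qed.

(** For [sink_seq l] this is the corner of the idempotent [sink_proj l]. *)
Definition sink_block l : set A :=
  [set x | sink_proj l ** x = x /\ x ** sink_proj l = x].

Lemma sink_block_mono l l' : sink_seq l -> sink_seq l' -> {subset l <= l'} ->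
  sink_block l `<=` sink_block l'.
Proof.
move=> sl sl' sub x [xl xr].
have pl : sink_proj l' ** sink_proj l = sink_proj l.
  rewrite {2 3}/sink_proj nmul_sumr big_seq [RHS]big_seq; apply: eq_bigr => mu ml.
  by rewrite nmulA sink_projl ?sub //; exact: sl.2.
have pr : sink_proj l ** sink_proj l' = sink_proj l.
  rewrite {1 3}/sink_proj nmul_suml big_seq [RHS]big_seq; apply: eq_bigr => mu ml.
  by rewrite -nmulA sink_projr ?sub //; exact: sl.2.
by split; [rewrite -xl nmulA pl|rewrite -xr -nmulA pr].
Qed.

Lemma sink_seq_cat l l' : sink_seq l -> sink_seq l' -> sink_seq (undup (l ++ l')).
Proof.
move=> [_ lu] [_ lu']; split; first exact: undup_uniq.
by move=> mu; rewrite mem_undup mem_cat => /orP[/lu|/lu'].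
Qed.

Lemma sink_block_catl l l' : sink_seq l -> sink_seq l' ->
  sink_block l `<=` sink_block (undup (l ++ l')).
Proof.
move=> sl sl'; apply: sink_block_mono => //; first exact: sink_seq_cat.
by move=> mu ml; rewrite mem_undup mem_cat ml.
Qed.

Lemma sink_block_catr l l' : sink_seq l -> sink_seq l' ->
  sink_block l' `<=` sink_block (undup (l ++ l')).
Proof.
move=> sl sl'; apply: sink_block_mono => //; first exact: sink_seq_cat.
by move=> mu ml; rewrite mem_undup mem_cat ml orbT.
Qed.

Lemma sink_block_cover x : exists2 l, sink_seq l & sink_block l x.
Proof.
elim: (sink_span x) => {x} [|x y _ [l sl hx] _ [l' sl' hy]|c x _ [l sl hx]|].
- by exists [::] => //; split; rewrite ?nmul0 ?nmul0l.
- exists (undup (l ++ l')); first exact: sink_seq_cat.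
  have [xl xr] := sink_block_catl sl sl' hx.
  have [yl yr] := sink_block_catr sl sl' hy.
  by split; rewrite ?nmulDr ?nmulDl ?xl ?yl ?xr ?yr.
- exists l => //; have [xl xr] := hx.
  by split; rewrite -?nscaleAr -?nscaleAl ?xl ?xr.
(* Duplicates are removed because [mu] and [nu] may coincide. *)
- move=> _ [mu [nu [em en ->]]]; have sl : sink_seq (undup [:: mu; nu]).
    split; first exact: undup_uniq.
    by move=> rho; rewrite mem_undup !inE => /orP[]/eqP->.
  exists (undup [:: mu; nu]) => //; split.
    by rewrite nmulA sink_projl // mem_undup !inE eqxx.
  by rewrite -nmulA sink_projr // mem_undup !inE eqxx orbT.
Qed.

Section Block.
Variables (mu0 : kpath L) (l0 : seq (kpath L)).
Local Notation l := (mu0 :: l0).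
Local Notation n := (size l0).
Hypothesis sl : sink_seq l.

Let tau (i : 'I_n.+1) := nth mu0 l i.

Let tau_src i : src (tau i) = u.
Proof. by apply: sl.2; rewrite mem_nth. Qed.

Let tau_gs i j : sg (tau i) ** s (tau j) = if i == j then s (vid u) else 0.
Proof. by rewrite kp_gs_sink // /tau nth_uniq //; exact: sl.1. Qed.

Let tau_proj : sink_proj l = \sum_i s (tau i) ** sg (tau i).
Proof. by rewrite /sink_proj (big_nth mu0) big_mkord. Qed.

(** One matrix algebra, presented as a product with a single factor to fit
    [matricial_subalgebra]. *)
Let phi (X : 'I_1 -> 'M[R]_n.+1) : A :=
  \sum_i \sum_j X ord0 i j *: (s (tau i) ** sg (tau j)).

Let phi_entry X i j : sg (tau i) ** phi X ** s (tau j) = X ord0 i j *: s (vid u).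
Proof.
rewrite /phi nmul_sumr nmul_suml (bigD1 i) //= [X in _ + X]big1 ?addr0; last first.
  move=> i' /negPf ne; rewrite nmul_sumr nmul_suml big1 // => j' _.
  by rewrite -nscaleAr nmulA tau_gs eq_sym ne nmul0l scaler0 nmul0l.
rewrite nmul_sumr nmul_suml (bigD1 j) //= big1 ?addr0; last first.
  move=> j' /negPf ne.
  by rewrite -nscaleAr -nscaleAl nmulA -nmulA !tau_gs ne nmul0 scaler0.
by rewrite -nscaleAr -nscaleAl nmulA -nmulA !tau_gs !eqxx kp_vv.
Qed.

Let phiM X Y : phi (fun i => X i *m Y i) = phi X ** phi Y.
Proof.
rewrite /phi nmul_suml; apply: eq_bigr => i _.
rewrite nmul_suml; under eq_bigr => j _ do rewrite mxE scaler_suml.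
rewrite exchange_big; apply: eq_bigr => j _ /=.
rewrite nmul_sumr [RHS](bigD1 j) //= [X in _ = _ + X]big1 ?addr0; last first.
  move=> j' /negPf ne; rewrite nmul_sumr big1 // => h _.
  rewrite -nscaleAl -nscaleAr nmulA -[s _ ** sg _ ** s _]nmulA tau_gs eq_sym ne.
  by rewrite nmul0 nmul0l !scaler0.
rewrite nmul_sumr; apply: eq_bigr => h _.
rewrite -nscaleAl -nscaleAr nmulA -[s _ ** sg _ ** s _]nmulA tau_gs eqxx.
by rewrite -(tau_src i) kp_sv // scalerA.
Qed.

Let phi1 : phi (fun=> 1%:M) = sink_proj l.
Proof.
rewrite tau_proj; apply: eq_bigr => i _; rewrite (bigD1 i) //= big1 ?addr0.
  by rewrite mxE eqxx scale1r.
by move=> j /negPf ne; rewrite mxE eq_sym ne scale0r.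
Qed.

Lemma sink_block_matricial : matricial_subalgebra (sink_block l).
Proof.
exists 1%N, (fun=> n), phi; split.
- move=> X Y; rewrite /phi -big_split; apply: eq_bigr => i _.
  by rewrite -big_split; apply: eq_bigr => j _; rewrite mxE scalerDl.
- move=> a X; rewrite /phi scaler_sumr; apply: eq_bigr => i _.
  by rewrite scaler_sumr; apply: eq_bigr => j _; rewrite mxE scalerA.
- exact: phiM.
- move=> X Y E; apply/funext => i; rewrite (ord1 i); apply/matrixP => a b.
  apply/eqP; rewrite -subr_eq0; apply/eqP.
  by apply: (kp_scale_vid fa (v := u)); rewrite scalerBl -!phi_entry E subrr.
apply/seteqP; split=> [_ [X _ <-]|x [xl xr]].
  split; rewrite -phi1 -phiM; congr phi; apply/funext => i.
    by rewrite mul1mx.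
  by rewrite mulmx1.
(* The entries of [x] are its compressions between the listed paths, which are scalars by
   [sink_corner]; expanding [x] between two copies of the projection then recovers it. *)
have /choice[r rE] : forall ij : 'I_n.+1 * 'I_n.+1, exists r : R,
    sg (tau ij.1) ** x ** s (tau ij.2) = r *: s (vid u).
  move=> [i j] /=; have [r rE] := sink_corner (sg (tau i) ** x ** s (tau j)).
  exists r; rewrite -rE !nmulA -{1}(tau_src i) kp_vg //.
  by rewrite -[RHS]nmulA -(tau_src j) kp_sv.
exists (fun=> \matrix_(i, j) r (i, j)) => //.
rewrite -xr -xl tau_proj nmul_suml nmul_suml; apply: eq_bigr => i _.
rewrite nmul_sumr; apply: eq_bigr => j _; rewrite mxE.
rewrite !nmulA -[s (tau i) ** _ ** x]nmulA -[s (tau i) ** _ ** s _]nmulA (rE (i, j)).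
by rewrite -nscaleAr -nscaleAl -(tau_src i) kp_sv.
Qed.

End Block.

Lemma sink_locally_matricial : locally_matricial A.
Proof.
exists [set B | exists mu l, sink_seq (mu :: l) /\ B = sink_block (mu :: l)].
have sv : sink_seq [:: vid u].
  by split=> // mu; rewrite inE => /eqP ->; rewrite src_vid.
split.
- by move=> _ [mu [l [sl ->]]]; exact: sink_block_matricial.
- move=> _ _ [mu [l [sl ->]]] [nu [l' [sl' ->]]].
  have ssc := sink_seq_cat sl sl'.
  exists (sink_block (undup ((mu :: l) ++ nu :: l'))); last first.
    move=> x [|]; first exact: sink_block_catl.
    exact: sink_block_catr.
  have : mu \in undup ((mu :: l) ++ nu :: l') by rewrite mem_undup mem_head.
  by case: (undup _) ssc => [//|rho t] st _; exists rho, t.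
apply/seteqP; split=> // x _; have [l sl lx] := sink_block_cover x.
(* The covering list may be empty while matrix sizes are positive, so [vid u] is adjoined to it. *)
have := sink_block_catr sv sl lx; have := sink_seq_cat sv sl.
have : vid u \in undup ([:: vid u] ++ l) by rewrite mem_undup mem_head.
case: (undup _) => [//|rho t] _ st xt.
by exists (sink_block (rho :: t)) => //; exists rho, t.
Qed.

(** Going round the cycle before a path to [u] gives paths [t n] ending at [u] of unbounded degree.
    The idempotent at the base of the cycle lies in a finite block, so it kills the long ones,
    although it fixes them all. *)
Lemma sink_no_cycle mu : ~ is_cycle mu.
Proof.
move=> [d0 e]; have [i di] : exists i, deg mu i <> 0%N.
  apply: contrapT => ni; apply: d0; apply/ffunP => i; rewrite ffunE.
  by apply: contrapT => di; apply: ni; exists i.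
(* A common bound of the base and the sink [u] is [u] itself, so [ta] ends at [u]. *)
have [w [[ta [rt st]] [ka [rk sk]]]] := vle_directed fa simple (rng mu) u.
have {}st : src ta = u by rewrite st -sk (sink rk) src_vid.
pose t n := iter n (pcomp mu) ta.
have rtn n : rng (t n) = rng mu.
  by elim: n => [//|n IH]; rewrite /= rng_comp // IH.
have stn n : src (t n) = u.
  by elim: n => [//|n IH]; rewrite /= src_comp // rtn.
have dtn n : (n <= deg (t n) i)%N.
  elim: n => [//|n IH]; rewrite /= deg_comp ?rtn // ffunE.
  by rewrite -add1n leq_add // lt0n; apply/eqP.
have [l sl [_ vl]] := sink_block_cover (s (vid (rng mu))).
pose N := (\max_(nu <- l) deg nu i).+1.
have Nl : t N \notin l.
  apply/negP => tl.
  have : (deg (t N) i <= \max_(nu <- l) deg nu i)%N by exact: leq_bigmax_seq.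
  by rewrite leqNgt; have := dtn N; rewrite {1}/N => ->.
apply: (kp_vid_neq0 fa simple (v := u)).
rewrite -(stn N) -kp_gs // -(kp_vs _ fa (t N)) rtn -vl -nmulA sink_projl //.
by rewrite (negPf Nl) !nmul0.
Qed.

End Sink.

(** * Terminal vertices and the dichotomy *)

Section Main.
Context (R : comPzRingType) (k : nat) (L : kgraph k).
Hypothesis fa : finitely_aligned L.
Hypothesis simple : simple_ring (KP R L).
Hypothesis fin : forall v : vertex L, finite_set [set w : vertex L | vle v w].
Implicit Types (lam mu nu rho sig eta al be : kpath L) (v w : vertex L).
Local Notation A := (KP R L).
Local Notation s := (@kp_s R k L).
Local Notation sg := (@kp_sg R k L).

(** Induction on the number of vertices above [v]: moving to a [w] above [v] from which [v] cannot
    be reached drops at least [v] from that set. *)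
Lemma terminal_above v : exists2 u, vle v u & forall w, vle u w -> vle w u.
Proof.
have [n] := ubnP #|` fset_set [set w | vle v w]|.
elim: n v => // n IH v; rewrite ltnS => le_n.
have [h|] := pselect (forall w, vle v w -> vle w v).
  by exists v => //; exact: vle_refl.
move=> /existsNP[w /not_implyP[vw nwv]].
have [|u wu hu] := IH w; last by exists u => //; exact: vle_trans wu.
apply: leq_trans le_n; apply: fproper_ltn_card; rewrite fproperE.
apply/andP; split; last apply/negP => /fsubsetP/(_ v).
  by apply/fsubsetP => z; rewrite !in_fset_set // !inE; exact: vle_trans.
by rewrite !in_fset_set // !inE => /(_ (vle_refl v))/nwv.
Qed.

Lemma terminal_top u : (forall w, vle u w -> vle w u) -> forall v, vle v u.
Proof.
move=> hu v; have [w [vw uw]] := vle_directed fa simple v u.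
exact: vle_trans (hu _ uw).
Qed.

(** Every path from [u] can be continued back to [u]; with nonzero degree this would close a
    cycle. *)
Lemma terminal_sink u : (forall w, vle u w -> vle w u) ->
  ~ (exists2 mu, is_cycle mu & rng mu = u) ->
  forall lam, rng lam = u -> lam = vid u.
Proof.
move=> hu nc lam rl.
have [ka [rk sk]] : vle (src lam) u by apply: hu; exists lam.
have d0 : deg lam = 0.
  apply: contrapT => d; apply: nc; exists (pcomp lam ka); rewrite ?rng_comp //.
  split; last by rewrite src_comp // rng_comp // sk rl.
  rewrite deg_comp // => h; apply: d; apply/ffunP => i.
  have := congr1 (fun f : degree k => f i) h; rewrite !ffunE => /eqP.
  by rewrite addn_eq0 => /andP[/eqP].
by have [v E] := (deg0P lam).1 d0; move: rl; rewrite E rng_vid => ->.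
Qed.

(** Aperiodicity of the pair [mu], [vid u] yields [eta] incompatible with [pcomp mu eta], and a
    return path [ka] closes both up at [u]. The projection of the resulting loop kills the path
    [eta] followed by [ka], while the idempotent of [u] fixes it. *)
Lemma terminal_split u mu : (forall w, vle u w -> vle w u) ->
  is_cycle mu -> rng mu = u ->
  exists lam, [/\ rng lam = u, src lam = u & s lam ** sg lam <> s (vid u)].
Proof.
move=> hu [d0 e] rm.
have [||eta ee nc] := @aperiodic _ _ _ fa simple mu (vid u).
- by rewrite src_vid e.
- by move=> E; apply: d0; rewrite E deg_vid.
have re : rng eta = u by rewrite -ee e.
have [ka [rk sk]] : vle (src eta) u by apply: hu; exists eta.
have er : src mu = rng (pcomp eta ka) by rewrite rng_comp.
exists (pcomp mu (pcomp eta ka)); split.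
- by rewrite rng_comp.
- by rewrite !src_comp.
move=> E; apply: (kp_vid_neq0 fa simple (v := src (pcomp eta ka))).
rewrite -kp_gs // -[s (pcomp eta ka)](kp_vs _ fa) rng_comp // re -E.
rewrite -nmulA kp_gs0 ?nmul0 // => c; apply: nc.
rewrite -[X in pcomp (vid X) _]re comp_vidl pcompA // in c *.
by apply: compat_pfx c; apply: pfx_comp; rewrite ?src_comp.
Qed.

Lemma terminal_purely_infinite u mu : (forall w, vle u w -> vle w u) ->
  is_cycle mu -> rng mu = u -> purely_infinite A.
Proof.
move=> hu cm rm I [[I0 IB] Ir] nI.
have [x Ix x0] : exists2 x, I x & x <> 0.
  apply: contrapT => no; apply: nI; apply/seteqP; split=> [x Ix|_ -> //].
  by apply: contrapT => x0; apply: no; exists x.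
have [a [b [v E]]] := kp_vertex_factor fa simple x0.
have [ka [rk sk]] := terminal_top hu v.
have [lam [rl sl ne]] := terminal_split hu cm rm.
set e := s (vid u) in ne *; set g := s lam in ne *; set h := sg lam in ne *.
have hg : h ** g = e by rewrite /h kp_gs // sl.
have ee : e ** e = e by exact: kp_vv.
have eg : e ** g = g by rewrite /e -rl kp_vs.
have ge : g ** e = g by rewrite /e -sl kp_sv.
have eh : e ** h = h by rewrite /e -sl kp_vg.
have he : h ** e = h by rewrite /e -rl kp_gv.
(* Compressing [x] to a vertex and moving up to [u] gives [q ** p = e] with [p] in [I]. Thus
   [p ** q] is an idempotent of [I] equivalent to [e], and conjugation by [p] and [q] carries the
   infiniteness of [e] over to it. *)
pose q := sg ka ** a; pose p := x ** b ** s ka.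
have qp : q ** p = e.
  rewrite /q /p !nmulA -[sg ka ** a ** x]nmulA -[_ ** (a ** x) ** b]nmulA E.
  by rewrite -rk kp_gv // kp_gs // sk.
have pe : p ** e = p by rewrite /p -nmulA /e -sk kp_sv.
have eq : e ** q = q by rewrite /q nmulA /e -sk kp_vg.
clearbody e g h; clear E.
have Ip : I p by rewrite /p -nmulA; exact: Ir.
clearbody p q.
have pq (y z : A) : p ** y ** q ** (p ** z ** q) = p ** (y ** e ** z) ** q.
  by rewrite -qp !nmulA.
have peq : p ** e ** q = p ** q by rewrite pe.
have ffp (z : A) : e ** z = z -> p ** q ** (p ** z ** q) = p ** z ** q.
  by move=> ez; rewrite -{1}peq pq ee ez.
have pff (z : A) : z ** e = z -> p ** z ** q ** (p ** q) = p ** z ** q.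
  by move=> ze; rewrite -peq pq ze ze.
exists (p ** q); first exact: Ir.
apply: (@infinite_idempotentI _ _ _ (p ** g ** q) (p ** h ** q)).
- by rewrite -{1}peq pff // pe.
- by rewrite pq he hg pe.
- exact: ffp.
- exact: pff.
- exact: ffp.
- exact: pff.
rewrite pq ge => H; apply: ne.
(* The conjugation can be undone, so properness for [p ** q] reduces to [g ** h <> e]. *)
have -> : g ** h = q ** (p ** (g ** h) ** q) ** p.
  by rewrite -!nmulA qp he !nmulA qp eg.
by rewrite H nmulA qp -nmulA qp ee.
Qed.

End Main.

Theorem corollary6p4 (R : comPzRingType) (k : nat) (hk : (1 <= k)%N)
    (L : kgraph k) (hfa : finitely_aligned L)
    (hfin : forall v : vertex L, finite_set [set w : vertex L | vle v w]%classic)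
    (hsimple : simple_ring (KP R L)) :
  (~ (exists mu : kpath L, is_cycle mu) -> locally_matricial (KP R L)) /\
  ((exists mu : kpath L, is_cycle mu) -> purely_infinite_simple (KP R L)).
Proof.
have [lam _] := path_exists hsimple.
have [u _ hu] := terminal_above hfin (src lam).
split=> [nc|[mu cmu]].
  apply: (sink_locally_matricial hfa hsimple (u := u)).
  by apply: terminal_sink => // -[mu cmu _]; apply: nc; exists mu.
split=> //.
have [[nu cnu rnu]|nc] := pselect (exists2 nu, is_cycle nu & rng nu = u).
  exact: (terminal_purely_infinite hfa hsimple hu cnu rnu).
by have := sink_no_cycle hfa hsimple (terminal_sink hu nc) cmu.
Qed.
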